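(* Let $p>1$ and let $\Omega$ be any bounded domain in $\mathbb R^2$. Let $H\in\mathscr H_D\setminus\{0\}$. If $\ker(H)$ is a half-plane, then the level $\lambda_p^H(\Omega)$ is never a fundamental frequency.
   Context: $\mathscr H$ is the set of functions $H:\mathbb R^2\to\mathbb R$ that are non-negative, convex and positively $1$-homogeneous ($H(tx)=tH(x)$ for every $t>0$ and $x\in\mathbb R^2$), $\mathscr H_D=\{H\in\mathscr H:\ H(x,y)=0\text{ for some }(x,y)\ne(0,0)\}$, and $\ker(H)=\{(x,y)\in\mathbb R^2:\ H(x,y)=0\}$; ''half-plane'' means a closed half-plane whose boundary line passes through the origin. For a bounded domain $\Omega\subset\mathbb R^2$, $W^{1,p}_0(\Omega)$ is the completion of the compactly supported smooth functions in $\Omega$ under the norm $(\int_\Omega|\nabla u|^p\,dx)^{1/p}$, and $$\lambda_p^H(\Omega):=\inf\Big\{\int_\Omega H^p(\nabla u)\,dx:\ u\in W_0^{1,p}(\Omega),\ \|u\|_{L^p(\Omega)}=1\Big\}.$$ The level $\lambda_p^H(\Omega)$ is called a fundamental frequency (of the operator $-\Delta_p^Hu=-\mathrm{div}(H^{p-1}(\nabla u)\nabla H(\nabla u))$ on $W_0^{1,p}(\Omega)$) if there exists a non-zero function $u_p\in W_0^{1,p}(\Omega)$ such that $\nabla H(\nabla u_p)$ is well-defined almost everywhere, is Lebesgue measurable in $\Omega$, and $$\int_\Omega H^{p-1}(\nabla u_p)\nabla H(\nabla u_p)\cdot\nabla\varphi\,dx=\lambda_p^H(\Omega)\int_\Omega|u_p|^{p-2}u_p\varphi\,dx\quad\text{for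 every }\varphi\in W_0^{1,p}(\Omega).$$ *)

(* Defs.v *)
From HB Require Import structures.
From mathcomp Require Import all_boot all_order all_algebra.
From mathcomp Require Import all_classical all_reals all_analysis.
From mathcomp Require Import measurable_realfun.

Set Implicit Arguments.
Unset Strict Implicit.
Unset Printing Implicit Defensive.

Import Order.TTheory GRing.Theory Num.Theory.
Import numFieldNormedType.Exports.

Local Open Scope classical_set_scope.
Local Open Scope ring_scope.

(* [R * R] with the sigma-algebra that [lebesgue_measure] expects on each
   factor; it is convertible to [R * R]. *)
Notation borel_plane R := (measurableTypeR R * measurableTypeR R)%type.

Notation lebesgue2 R := (@lebesgue_measure R \x @lebesgue_measure R)%E.

Section plane.
Context {R : realType}.

Definition dot2 (a b : R * R) : R := a.1 * b.1 + a.2 * b.2.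

(* The norm [`|a|] of the library on [R * R] is the maximum norm. *)
Definition euclid (a : R * R) : R := Num.sqrt (dot2 a a).

Definition partial (b : bool) (f : R * R -> R) (x : R * R) : R :=
  'D_(if b then (0, 1) else (1, 0)) f x.

Definition grad (f : R * R -> R) (x : R * R) : R * R :=
  (partial false f x, partial true f x).

(* [iterated_partial [:: b1; ..; bk] f] is the mixed partial derivative of [f]
   of order [k]; [smooth f] says that all of them exist and are continuous. *)
Definition iterated_partial (s : seq bool) (f : R * R -> R) : R * R -> R :=
  foldr partial f s.

Definition smooth (f : R * R -> R) : Prop :=
  forall s, continuous (iterated_partial s f) /\
    forall x : R * R, derivable (iterated_partial s f) x (1, 0) /\
                      derivable (iterated_partial s f) x (0, 1).

Definition bounded_domain (Omega : set (R * R)) : Prop :=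
  [/\ open Omega, connected Omega, Omega !=set0 & bounded_set Omega].

Definition test_function (Omega : set (R * R)) (f : R * R -> R) : Prop :=
  let supp := closure [set x | f x != 0] in
  [/\ smooth f, compact supp & supp `<=` Omega].

Definition Lp_norm (p : R) (Omega : set (R * R)) (f : R * R -> R) : \bar R :=
  'N[lebesgue2 R]_p%:E[ (EFin \o f) \_ Omega ].

(* [W0 p Omega u g]: the function [u], with gradient [g], belongs to
   W^{1,p}_0(Omega).  An element of the completion of the test functions for
   the norm |grad u|_p is the class of a Cauchy sequence [phi]; the gradients of
   [phi] converge in L^p to a field [g] and, Omega being bounded, Poincare's
   inequality makes [phi] converge in L^p to a function [u], the pair (u, g)
   determining the class and conversely.  Elements of L^p are given by Borel
   measurable representatives, only the values on Omega being relevant. *)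
Definition W0 (p : R) (Omega : set (R * R))
    (u : R * R -> R) (g : R * R -> R * R) : Prop :=
  [/\ measurable_fun (Omega : set (borel_plane R)) u,
      measurable_fun (Omega : set (borel_plane R)) g &
   exists phi : nat -> R * R -> R,
    [/\ forall n, test_function Omega (phi n),
        Lp_norm p Omega (fun x => phi n x - u x) @[n --> \oo] --> 0%E &
        Lp_norm p Omega (fun x => euclid (grad (phi n) x - g x)) @[n --> \oo]
          --> 0%E]].

Definition scriptH (H : R * R -> R) : Prop :=
  [/\ forall x, 0 <= H x,
      convex_function setT (H : convex_lmodType (R * R)%type -> R^o) &
      forall (t : R) (x : R * R), 0 < t -> H (t *: x) = t * H x].

Definition scriptH_D (H : R * R -> R) : Prop :=
  scriptH H /\ exists x : R * R, x != 0 /\ H x = 0.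

Definition ker (H : R * R -> R) : set (R * R) := [set x | H x = 0].

Definition half_plane (A : set (R * R)) : Prop :=
  exists nu : R * R, nu != 0 /\ A = [set x | 0 <= dot2 nu x].

Definition lambda (p : R) (H : R * R -> R) (Omega : set (R * R)) : \bar R :=
  ereal_inf [set l | exists u g,
    [/\ W0 p Omega u g, Lp_norm p Omega u = 1%E &
        l = (\int[lebesgue2 R]_(x in Omega) (H (g x) `^ p)%:E)%E]].

(* Measurability with respect to the completion of the Borel sigma-algebra. *)
Definition lebesgue_measurable_fun (D : set (R * R)) (f : R * R -> R * R) :
    Prop :=
  forall B, measurable B -> completed_algebra_gen (lebesgue2 R) (D `&` f @^-1` B).

(* [grad H] is total, but only its values at the points where [H] is
   differentiable matter here.  If [u x = 0] then
   [`|u x| `^ (p - 2) * u x = 0], whatever the exponent. *)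
Definition fundamental_frequency (p : R) (H : R * R -> R)
    (Omega : set (R * R)) : Prop :=
  exists u g,
  [/\ W0 p Omega u g,
      ~ {ae lebesgue2 R, forall x, Omega x -> u x = 0},
      {ae lebesgue2 R, forall x, Omega x -> differentiable H (g x)},
      lebesgue_measurable_fun Omega (fun x => grad H (g x)) &
      forall phi dphi, W0 p Omega phi dphi ->
      (\int[lebesgue2 R]_(x in Omega)
         (H (g x) `^ (p - 1) * dot2 (grad H (g x)) (dphi x))%:E
       = lambda p H Omega *
         \int[lebesgue2 R]_(x in Omega)
           (`|u x| `^ (p - 2) * u x * phi x)%:E)%E].

End plane.

(* Main.v *)
(* Write [H x = max 0 (e . x)], which is what a half-plane kernel forces, and put
   [v = e . grad u], [w = (v^+)^(p-1)], [k = |u|^(p-2) u].  The equation says that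
   [- D_e w = lambda k] weakly.  If [lambda > 0], then, [w >= 0] being minimal where
   [v <= 0], its derivative and hence [k] vanish there; so [v >= 0] wherever [u <> 0].
   A function of W^{1,p}_0 whose positive (resp. negative) part is monotone along [e]
   has no positive (resp. negative) part, because it vanishes at the exit of the
   bounded set Omega; so [u = 0].  If [lambda = 0], testing with [u] gives [v <= 0]
   and [u] itself is monotone along [e].  If [lambda = +oo], then [k] is orthogonal
   to every test function. *)
From HB Require Import structures.
Require Import Defs.
From mathcomp Require Import all_boot all_order all_algebra.
From mathcomp Require Import all_classical all_reals all_analysis.
From mathcomp Require Import measurable_realfun ring lra.

Set Implicit Arguments.
Unset Strict Implicit.
Unset Printing Implicit Defensive.

Import Order.TTheory GRing.Theory Num.Theory.
Import numFieldNormedType.Exports.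

Local Open Scope classical_set_scope.
Local Open Scope ring_scope.

(** The obstacle is regularity: [v] is only in L^p, so [w] has no derivative in the classical sense,
    and no chain rule or positive part is at hand for [u] itself. Every computation is therefore
    made on the test functions [phi n] approximating [u], with [flat 0], a smooth function vanishing
    exactly on the nonpositive half-line, in place of positive parts and indicators. That the
    derivative of [w] vanishes at its minima is read off functions of one real variable: [Wn n t] is
    the integral of [w] against the cutoff [flat 0 (- D n x) * flat 0 (s * phi j x)] translated by
    [t *: e]. It is nonnegative, its value at [0] tends to [0], and the weak equation computes its
    derivative. The second factor, with [j] fixed while [n] grows, keeps all supports in one compact
    part of Omega, so that one range of [t] serves every [n]. Limits are taken without extracting
    subsequences: each difference is bounded, for every eps > 0, by eps times a fixed integrable
    function plus a multiple of the p-th power of the L^p error density. *)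

(** * Borel sets of the plane and translation invariance of Lebesgue measure *)

Section lebesgue_plane.
Context {R : realType}.

Notation mu := (lebesgue2 R).

(** The product sigma-algebra is generated by boxes, and an open set is the union of the countably
    many boxes with rational centre and radius that it contains. *)
Lemma open_measurable_plane (A : set (R * R)) : open A ->
  measurable (A : set (borel_plane R)).
Proof.
move=> oA.
pose F (q : rat * rat * rat) : set (borel_plane R) :=
  let B := ball (ratr q.1.1 : R) (ratr q.2) `*` ball (ratr q.1.2 : R) (ratr q.2) in
  if pselect (B `<=` A) then B else set0.
suff -> : A = \bigcup_q F q.
  apply: countable_bigcupT_measurable => // -[[a b] r]; rewrite /F /=.
  have mB : measurable (ball (ratr a : R) (ratr r) `*` ball (ratr b : R) (ratr r)
      : set (borel_plane R)).
    by apply: measurableX; exact: measurable_ball.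
  by case: pselect => ? /=; [exact: mB | exact: measurable0].
apply/seteqP; split=> [x Ax|x [q _]]; last first.
  by rewrite /F; case: pselect => // h /h.
have /nbhs_ballP[e /= e0 eA] := oA _ Ax.
(* Half of [e], because the box of radius [r] is centred at a rational point which is itself only
   within [r] of [x]. *)
have [r /andP[r0 re]] : exists r : rat, 0 < (ratr r : R) < e / 2.
  by have [r] := @rat_in_itvoo R 0 (e / 2) ltac:(lra); rewrite in_itv/=; exists r.
have near (y : R) : exists q : rat, `|ratr q - y| < ratr r.
  have [q] := @rat_in_itvoo R (y - ratr r) (y + ratr r) ltac:(lra).
  by rewrite in_itv/= => /andP[? ?]; exists q; rewrite ltr_norml; apply/andP; split; lra.
have [[a ha] [b hb]] := (near x.1, near x.2).
exists (a, b, r) => //; rewrite /F /=; case: pselect => //=.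
case; apply: subset_trans eA => {oA Ax}.
move=> y [/= y1 y2]; split; rewrite /ball/= in y1 y2 *.
  by move: y1 y2 ha hb; rewrite !ltr_norml => /andP[? ?] /andP[? ?] /andP[? ?] /andP[? ?]; apply/andP; split; lra.
by move: y1 y2 ha hb; rewrite !ltr_norml => /andP[? ?] /andP[? ?] /andP[? ?] /andP[? ?]; apply/andP; split; lra.
Qed.

Lemma continuous_measurable_plane (f : R * R -> R) : continuous f ->
  measurable_fun setT (f : borel_plane R -> R).
Proof.
move=> /continuousP cf; apply: (measurability _ (RGenOpens.measurableE R)).
move=> _ [_ [a [b ->] <-]]; rewrite setTI; apply: open_measurable_plane.
exact/cf/interval_open.
Qed.

Definition translate (a : borel_plane R) : borel_plane R -> borel_plane R :=
  fun x => (x + a : R * R).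

Lemma measurable_translate a : measurable_fun setT (translate a).
Proof.
apply/measurable_fun_pairP; split.
  have : measurable_fun setT (fun x : borel_plane R => (x.1 : R) + a.1).
    by apply: measurable_funD => //; exact: measurable_fst.
  by apply: eq_measurable_fun => x _.
have : measurable_fun setT (fun x : borel_plane R => (x.2 : R) + a.2).
  by apply: measurable_funD => //; exact: measurable_snd.
by apply: eq_measurable_fun => x _.
Qed.

Definition translate1 (a : R) : measurableTypeR R -> measurableTypeR R :=
  fun x => (x + a : R).

Lemma measurable_translate1 a : measurable_fun setT (translate1 a).
Proof. exact: measurable_funD. Qed.

HB.instance Definition _ a := @isMeasurableFun.Build _ _ _ _ (translate1 a) (measurable_translate1 a).
HB.instance Definition _ a := @isMeasurableFun.Build _ _ _ _ (translate a) (measurable_translate a).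

Lemma lebesgue_measure_translate a (A : set (measurableTypeR R)) : measurable A ->
  lebesgue_measure (translate1 a @^-1` A) = lebesgue_measure A.
Proof.
move=> mA; symmetry.
apply: (@lebesgue_measure_unique R (pushforward lebesgue_measure (translate1 a))) => //.
move=> X [[x y] _ <-]; have shiftE : translate1 a @^-1` `]x, y]%classic = `](x - a), (y - a)]%classic.
  apply/seteqP; split=> z /=; rewrite /translate1 !in_itv/= => /andP[? ?]; apply/andP; split; lra.
transitivity (@lebesgue_measure R `](x - a), (y - a)]%classic); last first.
  exact: (congr1 lebesgue_measure (esym shiftE)).
rewrite !lebesgue_measure_itv/= !lte_fin ltrD2r; case: ifP => // _.
by rewrite -!EFinB; congr EFin; lra.
Qed.

(** Uniqueness of the product measure reduces this to boxes, hence to the invariance on each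
    factor. *)
Lemma lebesgue2_translate a (A : set (borel_plane R)) : measurable A ->
  mu (translate a @^-1` A) = mu A.
Proof.
move=> mA; symmetry.
apply: (@product_measure_unique _ _ _ _ R lebesgue_measure lebesgue_measure
  (pushforward mu (translate a))) => // B C mB mC.
rewrite -[LHS]/(mu (translate a @^-1` (B `*` C))).
have -> : translate a @^-1` (B `*` C) =
    (translate1 a.1 @^-1` B) `*` (translate1 a.2 @^-1` C) by [].
rewrite product_measure1E.
- by congr (_ * _)%E; exact: lebesgue_measure_translate.
- by have := @measurable_translate1 a.1 measurableT B mB; rewrite setTI.
- by have := @measurable_translate1 a.2 measurableT C mC; rewrite setTI.
Qed.

Lemma ge0_integral_translate a (f : borel_plane R -> \bar R) :
  measurable_fun setT f -> (forall x, 0 <= f x)%E ->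
  (\int[mu]_x f (translate a x) = \int[mu]_x f x)%E.
Proof.
move=> mf f0.
transitivity (\int[pushforward mu (translate a)]_x f x)%E.
  by rewrite ge0_integral_pushforward.
apply: eq_measure_integral => /= A mA _; exact: lebesgue2_translate.
Qed.

End lebesgue_plane.

(** * A smooth function that is flat at the origin *)

Section flat_function.
Context {R : realType}.
Implicit Types (t : R) (j : nat).

(* The functions [t^-j exp (-1/t)], extended by [0] to [t <= 0]: their linear
   span is stable under differentiation, whence the smoothness of [flat 0]. *)
Definition flat j t : R := if 0 < t then t^-1 ^+ j * expR (- t^-1) else 0.

Lemma flat_ge0 j t : 0 <= flat j t.
Proof.
rewrite /flat; case: ifP => // t0.
by rewrite mulr_ge0 ?expR_ge0// exprn_ge0// invr_ge0 ltW.
Qed.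

Lemma flat_eq0 j t : t <= 0 -> flat j t = 0.
Proof. by rewrite /flat leNgt; case: ltP. Qed.

Lemma flat_gt0 j t : 0 < t -> 0 < flat j t.
Proof. by rewrite /flat => t0; rewrite t0 mulr_gt0 ?expR_gt0// exprn_gt0// invr_gt0. Qed.

Lemma flatE j t : 0 < t -> flat j t = t^-1 ^+ j * expR (- t^-1).
Proof. by rewrite /flat => ->. Qed.

Lemma flatS j t : flat j t = t * flat j.+1 t.
Proof.
rewrite /flat; case: ifP => t0; last by rewrite mulr0.
by rewrite exprS !mulrA divff ?mul1r ?gt_eqF.
Qed.

(** With x = 1/t this is x^j <= j! exp x, one term of the exponential series. The cases used later
    are the bounds 1 for [flat 0] and 2 for [flat 2]. *)
Lemma flat_le j t : flat j t <= j`!%:R.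
Proof.
have [t0|t0] := leP t 0; first by rewrite flat_eq0.
rewrite flatE// expRN ler_pdivrMr ?expR_gt0//.
case: j => [|j]; first by rewrite expr0 mul1r -[leLHS]expR0 ler_expR invr_ge0 ltW.
have := @expR_ge1Dxn R t^-1 j; rewrite invr_ge0 (ltW t0) => /(_ isT) h.
rewrite mulrC -ler_pdivrMr ?ltr0n ?fact_gt0//; lra.
Qed.

Lemma is_derive_flat j t :
  is_derive t 1 (flat j) (flat j.+2 t - j%:R * flat j.+1 t).
Proof.
have [t0|t0|->] := ltgtP t 0.
- rewrite !flat_eq0 ?ltW// mulr0 subr0.
  apply: (@near_eq_is_derive _ _ _ (cst 0)).
  by near=> s; rewrite flat_eq0//; apply: ltW; near: s; exact: lt_nbhsl.
- rewrite !flatE//.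
  apply: (@near_eq_is_derive _ _ _ ((fun s => s^-1) ^+ j * (expR \o (fun s => - s^-1)))).
    near=> s; have s0 : 0 < s by near: s; exact: lt_nbhsr.
    by rewrite flatE// fctE /= exprfctE.
  have t0' : t != 0 by rewrite gt_eqF.
  have hV : is_derive t 1 (fun s : R => s^-1) (- t ^- 2).
    by have := @is_deriveV R id t 1 1 t0' _; rewrite scaler1; apply; exact: is_derive_id.
  have hE := @is_derive1_comp R expR (fun s => - s^-1) t _ _
    (is_derive_expR (- t^-1)) (is_deriveN hV).
  have hM := is_deriveM (is_deriveX j hV) hE.
  apply: (is_derive_eq hM); rewrite /= fctE /= scalerAr.
  rewrite /GRing.scale/= opprK.
  by case: j {hM} => [|j]; rewrite ?mulr0n ?expr0 ?exprS /=; field.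
- rewrite !flat_eq0// mulr0 subr0.
  have cvg0 : h^-1 *: (flat j (h + 0) - flat j 0) @[h --> 0^'] --> 0.
    (* By [flatS] the difference quotient at [0] is again a flat function; a second use of [flatS]
       bounds it by a multiple of [h] when [h > 0]. *)
    have e : \forall h \near (0:R)^', flat j.+1 h = h^-1 *: (flat j (h + 0) - flat j 0).
      near=> h; have h0 : h != 0 by near: h; exact: nbhs_dnbhs_neq.
      by rewrite addr0 (@flat_eq0 j 0)// subr0 (flatS j h) /GRing.scale/= mulrA mulVf ?mul1r.
    apply: (cvg_trans (near_eq_cvg e)).
    apply/cvgr0Pnorm_le => eps eps0; near=> h.
    rewrite ger0_norm ?flat_ge0// flatS.
    have [h0|h0] := leP h 0; first by rewrite flat_eq0// mulr0 ltW.
    rewrite (@le_trans _ _ (h * (j.+2)`!%:R))//.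
      by rewrite ler_wpM2l ?flat_le// ltW.
    rewrite -ler_pdivlMr ?ltr0n ?fact_gt0//; apply: le_trans (ler_norm _) _.
    near: h; apply: dnbhs0_le; rewrite divr_gt0// ltr0n; exact: fact_gt0.
  apply: DeriveDef.
    rewrite /derivable; apply/cvg_ex; exists 0.
    by under eq_fun do rewrite /= [_ *: 1]mulr1.
  rewrite /derive; apply/cvg_lim => //.
  by under eq_fun do rewrite /= [_ *: 1]mulr1.
Unshelve. all: by end_near. Qed.

Lemma flat_continuous j : continuous (flat j).
Proof.
by move=> t; have [h _] := is_derive_flat j t; exact/differentiable_continuous/derivable1_diffP.
Qed.

Lemma flat_measurable j : measurable_fun setT (flat j).
Proof. by apply: continuous_measurable_fun; exact: flat_continuous. Qed.

Lemma flat_lipschitz j : exists2 C, 0 < C & forall s t, `|flat j s - flat j t| <= C * `|s - t|.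
Proof.
exists ((j.+2)`!%:R + j%:R * (j.+1)`!%:R).
  by apply: ltr_pwDl; rewrite ?mulr_ge0 ?ler0n ?ltr0n ?fact_gt0.
move=> s t; wlog st : s t / s <= t.
  by move=> h; have [/h //|/ltW/h] := leP s t; rewrite distrC (distrC t).
have [|c _ e] := @MVT_segment R (flat j) _ s t st (fun c _ => is_derive_flat j c).
  by apply: continuous_subspaceT; exact: flat_continuous.
rewrite distrC e normrM (distrC t) ler_wpM2r//.
rewrite (le_trans (ler_normB _ _))// normrM !ger0_norm ?flat_ge0//.
by rewrite lerD ?flat_le// ler_wpM2l// flat_le.
Qed.

End flat_function.

(** * Calculus of smooth functions on the plane *)

Section smooth_functions.
Context {R : realType}.
Implicit Types (f g : R * R -> R) (x v e : R * R) (b : bool).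

Definition axis b : R * R := if b then (0, 1) else (1, 0).

Lemma partialE b f x : partial b f x = 'D_(axis b) f x.
Proof. by []. Qed.

(** Directional derivatives are read as derivatives in one real variable, where the chain rule and
    the mean value theorem are available. *)
Lemma derivable_lineP (t : R) x v f :
  derivable f (t *: v + x) v <-> derivable (fun s : R => f (s *: v + x)) t 1.
Proof.
rewrite /derivable (_ : (fun h => h^-1 *: (f (h *: v + (t *: v + x)) - f (t *: v + x))) =
  (fun h => h^-1 *: (((fun s => f (s *: v + x)) \o shift t) (h *: 1) - f (t *: v + x)))) //.
by apply/funext => h /=; rewrite [h *: 1]mulr1 scalerDl addrA.
Qed.

Lemma derive_line (t : R) x v f :
  'D_1 (fun s : R => f (s *: v + x)) t = 'D_v f (t *: v + x).
Proof.
rewrite /derive (_ : (fun h => h^-1 *: (((fun s => f (s *: v + x)) \o shift t) (h *: 1)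
    - f (t *: v + x))) =
  (fun h => h^-1 *: ((f \o shift (t *: v + x)) (h *: v) - f (t *: v + x)))) //.
by apply/funext => h /=; rewrite [h *: 1]mulr1 scalerDl addrA.
Qed.

Lemma is_derive_lineP (t : R) x v f d :
  is_derive (t *: v + x) v f d <-> is_derive t 1 (fun s : R => f (s *: v + x)) d.
Proof.
split=> -[h1 h2]; apply: DeriveDef.
- exact/derivable_lineP.
- by rewrite derive_line.
- exact/derivable_lineP.
- by rewrite -derive_line.
Qed.

Lemma is_derive_line0P x v f d :
  is_derive x v f d <-> is_derive (0 : R) 1 (fun s : R => f (s *: v + x)) d.
Proof. by rewrite -is_derive_lineP scale0r add0r. Qed.

Lemma is_derive_flat_comp j x v f d : is_derive x v f d ->
  is_derive x v (flat j \o f) ((flat j.+2 (f x) - j%:R * flat j.+1 (f x)) * d).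
Proof.
move=> /is_derive_line0P h; apply/is_derive_line0P.
have := @is_derive1_comp R (flat j) (fun s : R => f (s *: v + x)) 0 _ _
  (is_derive_flat j _) h.
by rewrite scale0r add0r.
Qed.

Lemma smooth_continuous f : smooth f -> continuous f.
Proof. by move=> /(_ [::]) []. Qed.

Lemma smooth_is_derive b f x : smooth f -> is_derive x (axis b) f (partial b f x).
Proof.
move=> /(_ [::]) [_ /(_ x) [h1 h2]].
by case: b; apply: DeriveDef; [exact: h2|exact: erefl|exact: h1|exact: erefl].
Qed.

Lemma smooth_partial b f : smooth f -> smooth (partial b f).
Proof. by move=> h s; have := h (rcons s b); rewrite /iterated_partial foldr_rcons. Qed.

(** A class stable under [partial] contains every iterated partial derivative of its members, so
    first-order information on the class is enough. *)
Lemma smooth_coind (C : (R * R -> R) -> Prop) :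
  (forall f, C f -> continuous f) ->
  (forall f b x, C f -> derivable f x (axis b)) ->
  (forall f b, C f -> C (partial b f)) ->
  forall f, C f -> smooth f.
Proof.
move=> Cc Cd Cp f Cf s.
have Cs : C (iterated_partial s f) by elim: s => //= b s; exact: Cp.
split; first exact: Cc.
by move=> x; split; [exact: (Cd _ false)|exact: (Cd _ true)].
Qed.

(** Differentiating a product or a composite [flat j \o f] produces sums of products of such
    functions; this class is closed under these rules and so is fit for [smooth_coind]. *)
Inductive smooth_algebra : (R * R -> R) -> Prop :=
| Alg_smooth f of smooth f : smooth_algebra f
| Alg_add f g of smooth_algebra f & smooth_algebra g : smooth_algebra (f \+ g)
| Alg_mul f g of smooth_algebra f & smooth_algebra g : smooth_algebra (f \* g)
| Alg_flat j f of smooth f : smooth_algebra (flat j \o f).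

Lemma smooth_cst (c : R) : smooth (cst c : R * R -> R).
Proof.
apply: (@smooth_coind (fun f => exists c, f = cst c)); last by exists c.
- by move=> _ [{}c ->]; exact: cst_continuous.
- by move=> _ b x [{}c ->]; exact: derivable_cst.
- move=> _ b [{}c ->]; exists 0; apply/funext => x; rewrite partialE.
  exact: derive_cst.
Qed.

Lemma smooth_algebraP f : smooth_algebra f ->
  [/\ continuous f, forall b x, derivable f x (axis b) &
      forall b, smooth_algebra (partial b f)].
Proof.
elim=> {f} [f sf|f g _ [cf df pf] _ [cg dg pg]|f g af [cf df pf] ag [cg dg pg]|j f sf].
- split; first exact: smooth_continuous.
    by move=> b x; have [] := smooth_is_derive b x sf.
  by move=> b; apply/Alg_smooth/smooth_partial.
- split; first by move=> x; apply: continuousD; [exact: cf|exact: cg].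
    by move=> b x; exact: derivableD.
  move=> b; have -> : partial b (f \+ g) = partial b f \+ partial b g.
    by apply/funext => x; rewrite partialE deriveD.
  exact: Alg_add.
- split; first by move=> x; apply: continuousM; [exact: cf|exact: cg].
    by move=> b x; exact: derivableM.
  move=> b; have -> : partial b (f \* g) = (f \* partial b g) \+ (partial b f \* g).
    apply/funext => x; rewrite partialE deriveM//= /GRing.scale/= !partialE.
    by rewrite (mulrC (g x)).
  by apply: Alg_add; apply: Alg_mul.
- split.
  + move=> x; apply: continuous_comp; first exact: smooth_continuous.
    exact: flat_continuous.
  + by move=> b x; have [] := is_derive_flat_comp j (smooth_is_derive b x sf).
  + move=> b; have -> : partial b (flat j \o f) =
      ((flat j.+2 \o f) \+ (cst (- j%:R) \* (flat j.+1 \o f))) \* partial b f.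
      apply/funext => x; have [_] := is_derive_flat_comp j (smooth_is_derive b x sf).
      by rewrite -partialE => -> /=; rewrite mulNr.
    apply: Alg_mul; last exact/Alg_smooth/smooth_partial.
    apply: Alg_add; first exact: Alg_flat.
    by apply: Alg_mul; [exact/Alg_smooth/smooth_cst|exact: Alg_flat].
Qed.

Lemma smooth_algebra_smooth f : smooth_algebra f -> smooth f.
Proof.
apply: smooth_coind => [{}f|{}f b x|{}f b] /smooth_algebraP[] //.
Qed.

Lemma smoothD f g : smooth f -> smooth g -> smooth (f \+ g).
Proof.
move=> sf sg; apply: smooth_algebra_smooth.
by apply: Alg_add; exact: Alg_smooth.
Qed.

Lemma smoothM f g : smooth f -> smooth g -> smooth (f \* g).
Proof.
move=> sf sg; apply: smooth_algebra_smooth.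
by apply: Alg_mul; exact: Alg_smooth.
Qed.

Lemma smooth_flat j f : smooth f -> smooth (flat j \o f).
Proof. by move=> sf; apply: smooth_algebra_smooth; exact: Alg_flat. Qed.

Lemma smoothZ (c : R) f : smooth f -> smooth (fun x => c * f x).
Proof. by move=> sf; exact: (@smoothM (cst c) f (smooth_cst c) sf). Qed.

Lemma is_derive_affine (a : R * R) (c : R) x v :
  is_derive x v (fun y => dot2 a y + c) (dot2 a v).
Proof.
apply/is_derive_line0P.
have -> : (fun s : R => dot2 a (s *: v + x) + c) =
          (fun s : R => s *: dot2 a v + (dot2 a x + c)).
  apply/funext => s; rewrite /dot2 /= /GRing.scale/=; ring.
have := @is_deriveD _ _ _ (fun s : R => s *: dot2 a v) (cst (dot2 a x + c)) 0 1 _ _ _ (is_derive_cst _ _ _).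
move=> /(_ (dot2 a v)); rewrite addr0; apply.
have := @is_deriveZ _ _ _ id (dot2 a v) (0 : R) 1 1 (is_derive_id _ _).
by rewrite [_ *: 1]mulr1; congr (is_derive _ _ _ _); apply/funext => s; rewrite /GRing.scale/= mulrC.
Qed.

Lemma affine_continuous (a : R * R) (c : R) : continuous (fun y : R * R => dot2 a y + c).
Proof.
move=> x; apply: continuousD; last exact: cst_continuous.
apply: continuousD.
  by apply: continuousM; [exact: cst_continuous|exact: cvg_fst].
by apply: continuousM; [exact: cst_continuous|exact: cvg_snd].
Qed.

Lemma smooth_affine (a : R * R) (c : R) : smooth (fun y => dot2 a y + c).
Proof.
apply: (@smooth_coind (fun f => exists a c, f = fun y => dot2 a y + c)); last by exists a, c.
- by move=> _ [{}a [{}c ->]]; exact: affine_continuous.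
- by move=> _ b x [{}a [{}c ->]]; have [] := is_derive_affine a c x (axis b).
- move=> _ b [{}a [{}c ->]]; exists 0, (dot2 a (axis b)); apply/funext => x.
  have [_ E] := is_derive_affine a c x (axis b); rewrite partialE [LHS]E.
  by rewrite /dot2 /= !mul0r !add0r.
Qed.

(** The segment is parametrized by [0, 1], which treats all signs of [r] at once, as well as
    [r = 0]. *)
Lemma MVT_partial b f x (r : R) : smooth f ->
  exists2 c, 0 <= c <= 1 &
    f (r *: axis b + x) - f x = r * partial b f ((c * r) *: axis b + x).
Proof.
move=> sf; pose F := (fun s : R => f (s *: axis b + x)) \o (fun s : R => s * r).
have dF (s : R) : is_derive s 1 F (partial b f ((s * r) *: axis b + x) * r).
  apply: is_derive1_comp.
    by apply/is_derive_lineP; exact: smooth_is_derive.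
  have := @is_deriveZ _ _ _ id r (s : R) 1 1 (is_derive_id _ _).
  by rewrite [_ *: 1]mulr1; congr (is_derive _ _ _ _); apply/funext => ?; rewrite mulrC.
have [|c] := MVT_segment (@ler01 R) (fun s _ => dF s).
  apply: continuous_subspaceT => s; have [h _] := dF s.
  exact/differentiable_continuous/derivable1_diffP.
rewrite in_itv/= /F /= mul1r mul0r scale0r add0r subr0 mulr1 => c01 ->.
by exists c => //; rewrite mulrC.
Qed.

(** [smooth] speaks of the axes only. A displacement along [e] is split into two axis displacements,
    the mean value theorem is applied to each, and the continuity of the partial derivatives
    concludes. *)
Lemma smooth_is_derive_dir f x e : smooth f -> is_derive x e f (dot2 e (grad f x)).
Proof.
move=> sf.
suff cv : h^-1 *: (f (h *: e + x) - f x) @[h --> (0:R)^'] --> dot2 e (grad f x).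
  apply: DeriveDef; first by apply/cvg_ex; exists (dot2 e (grad f x)).
  exact/cvg_lim.
have c1 := smooth_continuous (smooth_partial false sf).
have c2 := smooth_continuous (smooth_partial true sf).
apply/cvgrPdist_le => eps eps0.
(* [M] dominates each [|e.i|], which keeps the intermediate points near [x], and also their sum,
   which gives the final bound [eps]. *)
pose M := 1 + `|e.1| + `|e.2|.
have M1 : 1 <= M by rewrite /M -addrA lerDl addr_ge0.
have M0 : 0 < M by lra.
have eM0 : 0 < eps / M by rewrite divr_gt0.
have [d1 /= d10 hd1] : exists2 d, 0 < d & forall y, ball x d y ->
    `|partial false f x - partial false f y| <= eps / M.
  by have /cvgrPdist_le/(_ _ eM0)/nbhs_ballP[d d0 hd] := c1 x; exists d.
have [d2 /= d20 hd2] : exists2 d, 0 < d & forall y, ball x d y ->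
    `|partial true f x - partial true f y| <= eps / M.
  by have /cvgrPdist_le/(_ _ eM0)/nbhs_ballP[d d0 hd] := c2 x; exists d.
pose d := Num.min d1 d2 / M.
have d0 : 0 < d by rewrite divr_gt0 // lt_min d10.
near=> h.
have h0 : h != 0 by near: h; exact: nbhs_dnbhs_neq.
have hd : `|h| < d.
  near: h; exact: dnbhs0_lt.
pose y := (h * e.2) *: axis true + x.
have [a a01 ea] := MVT_partial false y (h * e.1) sf.
have [c c01 ec] := MVT_partial true x (h * e.2) sf.
have -> : f (h *: e + x) - f x = (h * e.1) * partial false f ((a * (h * e.1)) *: axis false + y)
      + (h * e.2) * partial true f ((c * (h * e.2)) *: axis true + x).
  rewrite -ea -ec -/y addrA subrK; congr (f _ - _); rewrite /y.
  by rewrite /axis; apply/pair_equal_spec; split; rewrite /= /GRing.scale/=; ring.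
set y1 := _ + y; set y2 := _ + x.
have step (s t : R) : 0 <= s <= 1 -> `|t| <= M -> `|s * (h * t)| < Num.min d1 d2.
  move=> /andP[s0 s1] tM; rewrite !normrM (ger0_norm s0).
  rewrite (@le_lt_trans _ _ (`|h| * M))//; last by rewrite -ltr_pdivlMr.
  rewrite -[leRHS]mul1r ler_pM// ?mulr_ge0// ler_wpM2l//.
have e1M : `|e.1| <= M by rewrite /M; have := normr_ge0 e.2; lra.
have e2M : `|e.2| <= M by rewrite /M; have := normr_ge0 e.1; lra.
have z01 : 0 <= (1:R) <= 1 by rewrite ler01 lexx.
have min0 : 0 < Num.min d1 d2 by rewrite lt_min d10.
have h1 : `|partial false f x - partial false f y1| <= eps / M.
  apply: hd1; apply: (@le_ball _ _ _ (Num.min d1 d2)); first by rewrite ge_min lexx.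
  rewrite /y1 /y /axis; split; rewrite /ball/= /GRing.scale/=.
    have -> : x.1 - (a * (h * e.1) * 1 + (h * e.2 * 0 + x.1)) = - (a * (h * e.1)) by ring.
    by rewrite normrN step.
  have -> : x.2 - (a * (h * e.1) * 0 + (h * e.2 * 1 + x.2)) = - (1 * (h * e.2)) by ring.
  by rewrite normrN step.
have h2 : `|partial true f x - partial true f y2| <= eps / M.
  apply: hd2; apply: (@le_ball _ _ _ (Num.min d1 d2)); first by rewrite ge_min lexx orbT.
  rewrite /y2 /axis; split; rewrite /ball/= /GRing.scale/=.
    have -> : x.1 - (c * (h * e.2) * 0 + x.1) = 0 by ring.
    by rewrite normr0.
  have -> : x.2 - (c * (h * e.2) * 1 + x.2) = - (c * (h * e.2)) by ring.
  by rewrite normrN step.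
have -> : dot2 e (grad f x) - h^-1 *: (h * e.1 * partial false f y1 + h * e.2 * partial true f y2)
  = e.1 * (partial false f x - partial false f y1) + e.2 * (partial true f x - partial true f y2).
  by rewrite /dot2 /grad /GRing.scale/=; field.
rewrite (le_trans (ler_normD _ _))// !normrM.
rewrite (@le_trans _ _ (`|e.1| * (eps / M) + `|e.2| * (eps / M)))//.
  by rewrite lerD// ler_wpM2l.
rewrite -mulrDl mulrA ler_pdivrMr// mulrC ler_wpM2l ?ltW// /M; lra.
Unshelve. all: by end_near. Qed.

Definition ddir e f x := dot2 e (grad f x).

Lemma ddirE e f : ddir e f = (fun x => e.1 * partial false f x + e.2 * partial true f x).
Proof. by []. Qed.

Lemma smooth_ddir e f : smooth f -> smooth (ddir e f).
Proof.
move=> sf; rewrite ddirE; apply: (@smoothD (fun x => e.1 * _) (fun x => e.2 * _)).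
  exact/smoothZ/smooth_partial.
exact/smoothZ/smooth_partial.
Qed.

Lemma ddir_val e f x d : smooth f -> is_derive x e f d -> ddir e f x = d.
Proof. by move=> sf [_ <-]; have [_ ->] := smooth_is_derive_dir x e sf. Qed.

Lemma is_derive_translate a x v f d : is_derive (x + a) v f d ->
  is_derive x v (fun y => f (y + a)) d.
Proof.
move=> /is_derive_line0P h; apply/is_derive_line0P.
by under eq_fun do rewrite -addrA.
Qed.

Lemma smooth_translate a f : smooth f -> smooth (fun y => f (y + a)).
Proof.
move=> sf; apply: (@smooth_coind (fun g => exists2 f, smooth f & g = fun y => f (y + a))).
- move=> _ [{sf}f sf ->] x; apply: continuous_comp; last exact: smooth_continuous.
  by apply: continuousD; [exact: cvg_id|exact: cst_continuous].
- move=> _ b x [{sf}f sf ->].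
  by have [] := is_derive_translate (smooth_is_derive b (x + a) sf).
- move=> _ b [{sf}f sf ->]; exists (partial b f); first exact: smooth_partial.
  apply/funext => x.
  by have [_ E] := is_derive_translate (smooth_is_derive b (x + a) sf); exact: E.
- by exists f.
Qed.

Lemma ddir_translate e a f x : smooth f ->
  ddir e (fun y => f (y + a)) x = ddir e f (x + a).
Proof.
move=> sf; apply: ddir_val; first exact: smooth_translate.
by apply: is_derive_translate; exact: smooth_is_derive_dir.
Qed.

End smooth_functions.

(** * Test functions: supports, bounds, small translations *)

Section test_functions.
Context {R : realType}.
Variable Omega : set (R * R).
Hypothesis oOmega : open Omega.
Implicit Types (f g : R * R -> R) (x e : R * R).

Notation supp f := (closure [set x | f x != 0]).

Lemma test_function_intro (K : set (R * R)) f : smooth f -> compact K ->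
  K `<=` Omega -> (forall x, f x != 0 -> K x) -> test_function Omega f.
Proof.
move=> sf cK KO fK.
have fK' : supp f `<=` K.
  rewrite [X in _ `<=` X](iffLR (closure_id K)); first exact: closure_subset.
  by apply: compact_closed => //; exact: norm_hausdorff.
split=> //; last exact: subset_trans KO.
by apply: subclosed_compact cK fK'; exact: closed_closure.
Qed.

Lemma test_function_of_supp f g : test_function Omega f -> smooth g ->
  (forall x, g x != 0 -> f x != 0) -> test_function Omega g.
Proof.
move=> [_ cf fO] sg gf; apply: test_function_intro sg cf fO _ => x gx.
by apply: subset_closure; exact: gf.
Qed.

(** Off its closed support [f] vanishes on a neighbourhood, hence so does its derivative. *)
Lemma ddir_supp e f x : smooth f -> ddir e f x != 0 -> supp f x.
Proof.
move=> sf; apply: contraNP => nx; apply/eqP; apply: ddir_val => //.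
apply: (@near_eq_is_derive _ _ _ (cst 0)).
have : nbhs x (~` supp f).
  by apply: open_nbhs_nbhs; split=> //; apply: closed_openC; exact: closed_closure.
apply: filterS => y /= ny; apply/esym/eqP; apply: contra_notT ny => fy.
exact: subset_closure.
Qed.

Lemma test_function_out f x : test_function Omega f -> ~ Omega x -> f x = 0.
Proof.
move=> [_ _ fO] nO; apply/eqP; apply: contra_notT nO => fx.
by apply: fO; exact: subset_closure.
Qed.

Lemma ddir_out e f x : test_function Omega f -> ~ Omega x -> ddir e f x = 0.
Proof.
move=> [sf _ fO] nO; apply/eqP; apply: contra_notT nO => fx.
by apply: fO; exact: ddir_supp fx.
Qed.

Lemma compact_supp_bounded (K : set (R * R)) f : continuous f -> compact K ->
  (forall x, f x != 0 -> K x) -> exists2 M, 0 < M & forall x, `|f x| <= M.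
Proof.
move=> cf cK fK.
have /compact_bounded[M [_ hM]] : compact (f @` K).
  by apply: continuous_compact cK; apply: continuous_subspaceT.
exists (`|M| + 1) => [|x]; first by rewrite ltr_wpDl.
have [->|fx] := eqVneq (f x) 0; first by rewrite normr0 addr_ge0.
apply: (hM (`|M| + 1)); first by rewrite ltr_pwDr// ler_norm.
by exists x => //; exact: fK.
Qed.

Lemma test_bounded f : test_function Omega f -> exists2 M, 0 < M & forall x, `|f x| <= M.
Proof.
move=> [sf cf _]; apply: compact_supp_bounded cf _; first exact: smooth_continuous.
by move=> x fx; exact: subset_closure.
Qed.

Lemma ddir_bounded e f : test_function Omega f ->
  exists2 M, 0 < M & forall x, `|ddir e f x| <= M.
Proof.
move=> [sf cf _]; apply: compact_supp_bounded cf _.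
  exact/smooth_continuous/smooth_ddir.
by move=> x; exact: ddir_supp.
Qed.

Lemma test_ddir e f : test_function Omega f -> test_function Omega (ddir e f).
Proof.
move=> [sf cf fO]; apply: test_function_intro cf fO _; first exact: smooth_ddir.
by move=> x; exact: ddir_supp.
Qed.

(** The tube lemma: each point of [K] has its own range of [t] by continuity, and compactness, in
    its near-covering form, makes the range uniform. *)
Lemma compact_translate_sub (K : set (R * R)) e : compact K -> K `<=` Omega ->
  exists2 h : R, 0 < h & forall t, `|t| < h -> forall x, K x -> Omega (t *: e + x).
Proof.
move=> cK KO.
have nc := (compact_near_coveringP K).1 cK R (nbhs (0:R)) (fun t x => Omega (t *: e + x)).
have /nbhs_ballP[h h0 hK] : \forall t \near (0:R), K `<=` (fun x => Omega (t *: e + x)).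
  apply: nc => x Kx.
  have : {for (x, 0), continuous (fun p : (R * R) * R => p.2 *: e + p.1)}.
    apply: continuousD; last exact: cvg_fst.
    by apply: continuousZr_tmp; exact: cvg_snd.
  move=> /(_ Omega); rewrite /= scale0r add0r; apply.
  by apply: open_nbhs_nbhs; split=> //; exact: KO.
exists h => // t th x Kx; apply: hK => //.
by rewrite /ball/= sub0r normrN.
Qed.

(** The quantifiers matter: [h] depends on [f] only and is chosen before [g], so it is common to a
    whole sequence of cutoffs that are nonzero only where [f] is. *)
Lemma test_function_translate e f : test_function Omega f ->
  exists2 h : R, 0 < h & forall g, smooth g -> (forall x, g x != 0 -> f x != 0) ->
    forall t, `|t| < h -> test_function Omega (fun x => g (x + t *: e)).
Proof.
move=> [sf cf fO]; have [h h0 hh] := compact_translate_sub e cf fO.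
exists h; first exact: h0.
move=> g sg gf t th.
apply: (@test_function_intro ((fun x => (- t) *: e + x) @` supp f)).
- exact: smooth_translate.
- apply: continuous_compact cf; apply: continuous_subspaceT => x.
  by apply: cvgD; [exact: cvg_cst|exact: cvg_id].
- by move=> _ [x fx <-]; apply: hh => //; rewrite normrN.
- move=> x gx; exists (x + t *: e).
    by apply: subset_closure; exact: gf.
  by rewrite addrC scaleNr addrK.
Qed.

End test_functions.

(** * Rules for the directional derivative *)

Section ddir_rules.
Context {R : realType}.
Implicit Types (f g : R * R -> R) (x e : R * R).

Lemma ddirM e f g x : smooth f -> smooth g ->
  ddir e (fun y => f y * g y) x = f x * ddir e g x + g x * ddir e f x.
Proof.
move=> sf sg; apply: ddir_val; first exact: (@smoothM _ f g).
have := is_deriveM (smooth_is_derive_dir x e sf) (smooth_is_derive_dir x e sg).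
by [].
Qed.

Lemma ddir_flat e j f x : smooth f ->
  ddir e (fun y => flat j (f y)) x = (flat j.+2 (f x) - j%:R * flat j.+1 (f x)) * ddir e f x.
Proof.
move=> sf; apply: ddir_val; first exact: (@smooth_flat _ j f).
exact/is_derive_flat_comp/smooth_is_derive_dir.
Qed.

Lemma ddir_affine e a c x : ddir e (fun y => dot2 a y + c) x = dot2 a e :> R.
Proof. by apply: ddir_val; [exact: smooth_affine|exact: is_derive_affine]. Qed.

Lemma ddirNl e f x : ddir (- e) f x = - ddir e f x.
Proof. by rewrite /ddir /dot2 /= !mulNr opprD. Qed.

Lemma gradN f x : smooth f -> grad (fun y => - f y) x = - grad f x.
Proof.
move=> sf; have dN b : partial b (fun y => - f y) x = - partial b f x.
  by have [_ E] := is_deriveN (smooth_is_derive b x sf); exact: E.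
by rewrite /grad !dN.
Qed.

Lemma smoothN f : smooth f -> smooth (fun y => - f y).
Proof.
move=> sf; have := smoothZ (-1) sf; congr smooth.
by apply/funext => x; rewrite mulN1r.
Qed.

End ddir_rules.

(** * Finite measure of a bounded open set *)

Section finite_measure.
Context {R : realType}.
Variable Omega : set (R * R).

Lemma bounded_measure_fin : open Omega -> bounded_set Omega ->
  (lebesgue2 R (Omega : set (borel_plane R)) < +oo)%E.
Proof.
move=> oO [M [_ hM]]; pose N := `|M| + 1.
have hN x : Omega x -> `|x| <= N by apply: hM; rewrite /N ltr_pwDr// ler_norm.
pose I : set (measurableTypeR R) := `[- N, N]%classic.
have mI : measurable I by exact: measurable_itv.
apply: (@le_lt_trans _ _ (lebesgue2 R (I `*` I))).
  apply: le_measure; rewrite ?inE.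
  - exact: open_measurable_plane.
  - exact: measurableX.
  move=> x /hN; rewrite prod_normE ge_max => /andP[].
  by rewrite !ler_norml => h1 h2; split; rewrite /I /= in_itv.
rewrite product_measure1E// [X in (X * X)%E]lebesgue_measure_itv/=.
by case: ifP => _; rewrite ?mule0 ?ltry// -EFinB -EFinM ltry.
Qed.

End finite_measure.

(** * Young-type inequalities for real powers *)

Section power_inequalities.
Context {R : realType}.
Variables (p : R) (p1 : 1 < p).

Let p0 : 0 < p. Proof. exact: lt_trans p1. Qed.

Lemma powRB1M (a : R) : 0 <= a -> a `^ (p - 1) * a = a `^ p.
Proof. by move=> a0; rewrite mulrC mulr_powRB1. Qed.

Lemma le_1DpowR (x r : R) : 0 <= x -> 0 < r -> r <= p -> x `^ r <= 1 + x `^ p.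
Proof.
move=> x0 r0 rp; have [x1|x1] := leP x 1.
  rewrite (@le_trans _ _ 1)// ?lerDl ?powR_ge0//.
  have -> : 1 = 1 `^ r :> R by rewrite powR1.
  by rewrite ge0_ler_powR ?nnegrE// ltW.
by rewrite (@le_trans _ _ (x `^ p))// ?lerDr// ler_powR// ltW.
Qed.

(** Young's inequality without sharp constants: either [b <= eps * a] and the first term suffices,
    or [a < b / eps] and the second one does, which dictates [K]. *)
Lemma powR_young (eps : R) : 0 < eps -> exists2 K, 0 < K & forall a b, 0 <= a -> 0 <= b ->
  a `^ (p - 1) * b <= eps * a `^ p + K * b `^ p.
Proof.
move=> e0; exists (eps^-1 `^ (p - 1)); first by rewrite powR_gt0// invr_gt0.
move=> a b a0 b0; have [bea|aeb] := leP b (eps * a).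
  rewrite (@le_trans _ _ (eps * a `^ p))// ?lerDl ?mulr_ge0 ?powR_ge0//.
  by rewrite -powRB1M// mulrCA ler_wpM2l ?powR_ge0.
rewrite (@le_trans _ _ (eps^-1 `^ (p - 1) * b `^ p))//; last first.
  by rewrite lerDr mulr_ge0 ?powR_ge0// ltW.
rewrite -(powRB1M b0) mulrA -powRM ?invr_ge0// ?(ltW e0)//.
rewrite ler_wpM2r// ge0_ler_powR ?nnegrE ?mulr_ge0 ?invr_ge0 ?(ltW e0)//.
  by rewrite subr_ge0 ltW.
by rewrite mulrC ler_pdivlMr// mulrC ltW.
Qed.

(** Meant for [x] and [y] both controlled in L^p, which are not conjugate exponents unless [p = 2];
    the bound [y <= M] makes up for it. The cases are [y] small, [x] small, and [x] large. *)
Lemma mul_bounded_young (eps M : R) : 0 < eps -> 0 < M -> exists2 K, 0 < K &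
  forall x y, 0 <= x -> 0 <= y -> y <= M ->
  x * y <= eps * (1 + x `^ p) + K * y `^ p.
Proof.
(* [X] solves [M = eps * X]^ (p - 1)[, so that]M * x <= eps * x [^ p] beyond it. *)
move=> e0 M0; pose X := (M / eps) `^ (p - 1)^-1.
have X0 : 0 < X by apply: powR_gt0; rewrite divr_gt0.
have ep0 : 0 < eps `^ p by rewrite powR_gt0.
exists (M * X / eps `^ p); first by rewrite divr_gt0 ?mulr_gt0.
move=> x y x0 y0 yM.
have xp0 : 0 <= x `^ p by exact: powR_ge0.
have yp0 : 0 <= y `^ p by exact: powR_ge0.
have K0 : 0 <= M * X / eps `^ p * y `^ p.
  by rewrite mulr_ge0// divr_ge0// ?(ltW ep0)// mulr_ge0 ?ltW.
have [ye|ey] := leP y eps.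
  rewrite (@le_trans _ _ (eps * (1 + x `^ p)))// ?lerDl//.
  rewrite mulrC ler_pM//; have := @le_1DpowR x 1 x0 ltr01 (ltW p1).
  by rewrite powRr1.
have [xX|Xx] := leP x X.
  rewrite (@le_trans _ _ (M * X / eps `^ p * y `^ p))//; last first.
    by rewrite lerDr mulr_ge0 ?(ltW e0)// addr_ge0.
  rewrite (@le_trans _ _ (M * X))//; first by rewrite mulrC ler_pM.
  rewrite -mulrA ler_peMr ?mulr_ge0 ?(ltW M0) ?(ltW X0)//.
  rewrite mulrC ler_pdivlMr// mul1r ge0_ler_powR ?nnegrE ?(ltW p0)//.
    exact: ltW.
  exact: ltW.
rewrite (@le_trans _ _ (eps * x `^ p))//; last first.
  by rewrite -[leLHS]addr0 lerD// ler_wpM2l ?(ltW e0)// lerDr.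
rewrite (@le_trans _ _ (x * M))//; first by rewrite ler_wpM2l.
rewrite -powRB1M// mulrA mulrC ler_wpM2r// mulrC -ler_pdivrMr//.
have -> : M / eps = X `^ (p - 1).
  rewrite /X -powRrM mulVf ?powRr1// ?divr_ge0 ?ltW//.
  by rewrite gt_eqF// subr_gt0.
by apply: ge0_ler_powR; rewrite ?nnegrE ?subr_ge0 ?(ltW p1) ?(ltW X0) ?(ltW Xx).
Qed.

Lemma powRD_le (a b : R) : 0 <= a -> 0 <= b -> (a + b) `^ p <= 2 `^ p * (a `^ p + b `^ p).
Proof.
move=> a0 b0; wlog ab : a b a0 b0 / a <= b.
  move=> h; have [|/ltW] := leP a b; first exact: h.
  by move=> ba; rewrite addrC (addrC (a `^ p)); exact: h.
rewrite (@le_trans _ _ ((2 * b) `^ p))//.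
  by rewrite ge0_ler_powR ?nnegrE ?(ltW p0) ?addr_ge0 ?mulr_ge0//; lra.
by rewrite powRM// ler_wpM2l ?powR_ge0// lerDr powR_ge0.
Qed.

End power_inequalities.

(** * Integrable functions and convergence of integrals *)

Section L1.
Context d (T : measurableType d) (R : realType) (mu : {measure set T -> \bar R}).
Implicit Types (f g A b : T -> R).

Definition L1 f := mu.-integrable setT (EFin \o f).

Lemma L1_measurable f : L1 f -> measurable_fun setT f.
Proof. by move=> /integrableP[/measurable_EFinP]. Qed.

Lemma L1_le f g : measurable_fun setT f -> (forall x, `|f x| <= g x) -> L1 g -> L1 f.
Proof.
move=> mf fg; apply: le_integrable => //; first exact/measurable_EFinP.
by move=> x _; rewrite /= lee_fin (le_trans (fg x))// ler_norm.
Qed.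

Lemma L1D f g : L1 f -> L1 g -> L1 (fun x => f x + g x).
Proof. by move=> lf lg; exact: (integrableD measurableT lf lg). Qed.

Lemma L1B f g : L1 f -> L1 g -> L1 (fun x => f x - g x).
Proof. by move=> lf lg; exact: (integrableB measurableT lf lg). Qed.

Lemma L1Z (c : R) f : L1 f -> L1 (fun x => c * f x).
Proof. by move=> lf; exact: (integrableZl measurableT c lf). Qed.

Lemma L1_norm f : L1 f -> L1 (fun x => `|f x|).
Proof. by move=> lf; exact: (integrable_norm lf). Qed.

Lemma L1_mul_bounded f g (M : R) : L1 f -> measurable_fun setT g ->
  (forall x, `|g x| <= M) -> L1 (fun x => f x * g x).
Proof.
move=> lf mg gM; apply: (@L1_le _ (fun x => M * `|f x|)).
- by apply: measurable_funM => //; exact: L1_measurable.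
- by move=> x; rewrite normrM mulrC ler_wpM2r.
- exact/L1Z/L1_norm.
Qed.

Lemma L1_EFin f : L1 f -> (\int[mu]_x (f x)%:E)%E = (\int[mu]_x f x)%:E.
Proof.
by move=> lf; rewrite /Rintegral fineK//; exact: integrable_fin_num.
Qed.

(** The error [b] is only measurable and may have infinite integral, hence a bound in the extended
    reals. *)
Lemma Rintegral_dist f g A b (eps K : R) : L1 f -> L1 g -> L1 A ->
  measurable_fun setT b -> (forall x, 0 <= A x) -> (forall x, 0 <= b x) ->
  0 <= eps -> 0 <= K ->
  (forall x, `|f x - g x| <= eps * A x + K * b x) ->
  ((`|\int[mu]_x f x - \int[mu]_x g x|)%:E <=
   (eps * \int[mu]_x A x)%:E + K%:E * \int[mu]_x (b x)%:E)%E.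
Proof.
move=> lf lg lA mb A0 b0 e0 K0 h.
rewrite -RintegralB//.
have lfg := L1B lf lg.
apply: (@le_trans _ _ (\int[mu]_x `|f x - g x|)%R%:E).
  by rewrite lee_fin; exact: le_normr_Rintegral.
rewrite -L1_EFin; last exact: (L1_norm lfg).
apply: (@le_trans _ _ (\int[mu]_x (eps * A x + K * b x)%:E)%E).
  apply: ge0_le_integral => //.
  - by apply/measurable_EFinP; exact: (L1_measurable (L1_norm lfg)).
  - apply/measurable_EFinP; apply: measurable_funD; apply: measurable_funM => //.
    exact: L1_measurable.
  - by move=> x _; rewrite lee_fin.
under eq_integral do rewrite EFinD.
rewrite ge0_integralD//; first last.
- by apply/measurable_EFinP; apply: measurable_funM.
- by move=> x _; rewrite lee_fin mulr_ge0.
- by apply/measurable_EFinP; apply: measurable_funM => //; exact: L1_measurable.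
- by move=> x _; rewrite lee_fin mulr_ge0.
rewrite leeD//.
  by rewrite (L1_EFin (L1Z eps lA)) RintegralZl.
under eq_integral do rewrite EFinM.
by rewrite ge0_integralZl//; [exact/measurable_EFinP|move=> x _; rewrite lee_fin].
Qed.

(** This takes the place of dominated convergence and requires no pointwise convergence. The index
    [i] is to be a translation parameter: translating an error leaves its integral unchanged, whence
    a bound [beta n] free of [i]. *)
Lemma Rintegral_uniform_cvg (I : Type) (F : nat -> I -> T -> R) (G : I -> T -> R)
    A (b : nat -> I -> T -> R) (beta : nat -> \bar R) :
  (forall n i, L1 (F n i)) -> (forall i, L1 (G i)) -> L1 A ->
  (forall n i, measurable_fun setT (b n i)) ->
  (forall x, 0 <= A x) -> (forall n i x, 0 <= b n i x) ->
  beta n @[n --> \oo] --> 0%E ->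
  (forall n i, \int[mu]_x (b n i x)%:E <= beta n)%E ->
  (forall eps, 0 < eps -> exists2 K, 0 < K & forall n i x,
     `|F n i x - G i x| <= eps * A x + K * b n i x) ->
  forall eps, 0 < eps -> \forall n \near \oo, forall i,
    `|\int[mu]_x F n i x - \int[mu]_x G i x| <= eps.
Proof.
move=> lF lG lA mb A0 b0 cb hb h eps e0.
pose a := \int[mu]_x A x.
have a0 : 0 <= a by exact: Rintegral_ge0.
have a10 : 0 < a + 1 by rewrite ltr_pwDr.
have e20 : 0 < eps / 2 / (a + 1) by rewrite !divr_gt0.
have [K K0 hK] := h _ e20.
have eK0 : 0 < eps / 2 / K by rewrite !divr_gt0.
have /fine_cvgP[bfin /cvgrPdist_le/(_ _ eK0) bsmall] := cb.
near=> n => i.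
have bn : (beta n <= (eps / 2 / K)%:E)%E.
  have bf : beta n \is a fin_num by near: n.
  rewrite -(fineK bf) lee_fin (le_trans (ler_norm _))//.
  by rewrite -normrN -sub0r; near: n.
rewrite -lee_fin.
have := @Rintegral_dist _ _ A (b n i) _ K (lF n i) (lG i) lA (mb n i) A0 (b0 n i)
  (ltW e20) (ltW K0) (hK n i).
move=> /le_trans; apply.
apply: (@le_trans _ _ ((eps / 2)%:E + K%:E * (eps / 2 / K)%:E)%E).
  rewrite leeD//.
    rewrite lee_fin mulrAC ler_pdivrMr// ler_wpM2l ?divr_ge0 ?ltW//.
    by rewrite -/a ltrDl.
  apply: lee_wpmul2l; first by rewrite lee_fin ltW.
  exact: le_trans (hb n i) bn.
by rewrite -EFinM -EFinD lee_fin le_eqVlt; apply/orP; left; apply/eqP; field; rewrite gt_eqF.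
Unshelve. all: by end_near. Qed.

Lemma Rintegral_cvg (F : nat -> T -> R) (G : T -> R) A (b : nat -> T -> R) :
  (forall n, L1 (F n)) -> L1 G -> L1 A ->
  (forall n, measurable_fun setT (b n)) ->
  (forall x, 0 <= A x) -> (forall n x, 0 <= b n x) ->
  (\int[mu]_x (b n x)%:E @[n --> \oo] --> 0)%E ->
  (forall eps, 0 < eps -> exists2 K, 0 < K & forall n x,
     `|F n x - G x| <= eps * A x + K * b n x) ->
  \int[mu]_x F n x @[n --> \oo] --> \int[mu]_x G x.
Proof.
move=> lF lG lA mb A0 b0 cb h; apply/cvgrPdist_le => eps e0.
have := @Rintegral_uniform_cvg unit (fun n _ => F n) (fun=> G) A (fun n _ => b n) _
  (fun n _ => lF n) (fun=> lG) lA (fun n _ => mb n) A0 (fun n _ => b0 n) cb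
  (fun n _ => lexx _) _ eps e0.
move=> H; have {H} : \forall n \near \oo, forall i : unit,
    `|\int[mu]_x F n x - \int[mu]_x G x| <= eps.
  by apply: H => e /h[K K0 hK]; exists K.
by apply: filterS => n /(_ tt); rewrite distrC.
Qed.

Lemma Rintegral_eq0_ae f : L1 f -> {ae mu, forall x, 0 <= f x} -> \int[mu]_x f x = 0 ->
  {ae mu, forall x, f x = 0}.
Proof.
move=> lf f0 f00.
have mf : measurable_fun setT (EFin \o f) by apply/measurable_EFinP; exact: L1_measurable.
have : (\int[mu]_x `|(f x)%:E| = 0)%E.
  rewrite -[RHS](_ : (\int[mu]_x (f x)%:E = 0)%E); last by rewrite L1_EFin// f00.
  apply: ae_eq_integral => //; first exact: measurableT_comp.
  by apply: filterS f0 => x f0 _; rewrite gee0_abs// lee_fin.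
move/(iffLR (ae_eq_integral_abs mu measurableT mf)).
by apply: filterS => x /(_ I) []; exact.
Qed.

End L1.

(** * Integrals against translated functions; the divergence theorem *)

Section translated_integrals.
Context {R : realType}.
Notation mu := (lebesgue2 R).
Implicit Types (w f : borel_plane R -> R) (chi : R * R -> R) (e : R * R).

Lemma Rintegral_translate a f : measurable_fun setT f ->
  \int[mu]_x f (translate a x) = \int[mu]_x f x.
Proof.
move=> mf; rewrite /Rintegral; congr fine.
have mf' : measurable_fun setT (EFin \o f) by exact/measurable_EFinP.
have tp := ge0_integral_translate a (measurable_funepos mf') (fun x => funepos_ge0 (EFin \o f) x).
have tn := ge0_integral_translate a (measurable_funeneg mf') (fun x => funeneg_ge0 (EFin \o f) x).
rewrite [LHS]integralE [RHS]integralE -tp -tn.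
by congr (_ - _)%E; apply: eq_integral => x _; rewrite ?funeposE ?funenegE.
Qed.

Lemma continuous_translate_measurable chi a : continuous chi ->
  measurable_fun setT (fun x : borel_plane R => chi (x + a)).
Proof.
move=> cc; apply: continuous_measurable_plane => x.
apply: continuous_comp; last exact: cc.
by apply: cvgD; [exact: cvg_id|exact: cvg_cst].
Qed.

(** The derivative falls on the smooth factor, so integrability is all that is asked of [w];
    differentiation under the integral is dominated by [N * |w|]. *)
Lemma is_derive_integral_translate w chi e (M N t : R) : L1 mu w -> smooth chi ->
  (forall x, `|chi x| <= M) -> (forall x, `|ddir e chi x| <= N) ->
  is_derive t 1 (fun s : R => \int[mu]_x (w x * chi (x + s *: e)))
    (\int[mu]_x (w x * ddir e chi (x + t *: e))).
Proof.
move=> lw sc cM dN.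
pose f (s : R) (x : borel_plane R) := w x * chi (x + s *: e).
have lf s : L1 mu (f s).
  apply: (L1_mul_bounded lw) => [|x]; last exact: cM.
  by apply: continuous_translate_measurable; exact: smooth_continuous.
have df (s : R) x : is_derive s 1 (f ^~ x) (w x * ddir e chi (x + s *: e)).
  have h : is_derive s 1 (fun r : R => chi (r *: e + x)) (ddir e chi (s *: e + x)).
    by apply/is_derive_lineP; exact: smooth_is_derive_dir.
  have := is_deriveZ (w x) h; rewrite [x + _]addrC; congr (is_derive _ _ _ _).
  by apply/funext => r; rewrite /f [x + _]addrC.
have d1f s x : partial1of2 f s x = w x * ddir e chi (x + s *: e).
  by rewrite partial1of2E; have [_] := df s x.
pose G x := N * `|w x|.
have It : `]t - 1, t + 1[%classic t by rewrite /= in_itv/=; apply/andP; split; lra.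
have intf s : `]t - 1, t + 1[%classic s -> mu.-integrable setT (EFin \o f s) by move=> _; exact: lf.
have derf s x : `]t - 1, t + 1[%classic s -> setT x -> derivable (f ^~ x) s 1.
  by move=> _ _; have [] := df s x.
have N0 : 0 <= N by exact: le_trans (dN 0).
have G0 x : 0 <= G x by rewrite mulr_ge0.
have iG : mu.-integrable setT (EFin \o G) by exact: (L1Z N (L1_norm lw)).
have Gub s x : `]t - 1, t + 1[%classic s -> setT x -> `|partial1of2 f s x| <= G x.
  by move=> _ _; rewrite d1f normrM mulrC ler_wpM2r.
apply: DeriveDef.
  exact: (derivable_under_integral measurableT It intf derf G0 iG Gub).
have := differentiation_under_integral measurableT It intf derf G0 iG Gub.
rewrite derive1E => ->; apply: eq_Rintegral => x _; exact: d1f.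
Qed.

Lemma L1_bounded_supp (Omega : set (R * R)) f (M : R) : open Omega -> bounded_set Omega ->
  measurable_fun setT f -> (forall x, `|f x| <= M) -> (forall x, ~ Omega x -> f x = 0) ->
  L1 mu f.
Proof.
move=> oO bO mf fM f0.
have mO := open_measurable_plane oO.
pose one : borel_plane R -> R := \1_Omega.
suff : L1 mu (fun x => M * one x).
  apply: L1_le => //; rewrite /one.
  move=> x; have [Ox|nOx] := pselect (Omega x).
    by rewrite indicE mem_set// mulr1.
  by rewrite f0// normr0 indicE memNset// mulr0.
apply: L1Z; apply/integrableP; split.
  by apply/measurable_EFinP; exact: measurable_indic.
under eq_integral do rewrite /= ger0_norm//.
by rewrite integral_indic// setIT; exact: bounded_measure_fin.
Qed.

Lemma test_L1 (Omega : set (R * R)) chi : open Omega -> bounded_set Omega ->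
  test_function Omega chi -> L1 mu chi.
Proof.
move=> oO bO tc; have [M _ cM] := test_bounded tc.
apply: (L1_bounded_supp oO bO _ cM).
  by apply: continuous_measurable_plane; apply: smooth_continuous; case: tc.
by move=> x; exact: test_function_out.
Qed.

(** The integral of [chi (x + t *: e)] does not depend on [t], and its derivative at [t = 0] is the
    integral in question. *)
Lemma integral_ddir_eq0 (Omega : set (R * R)) e chi : open Omega -> bounded_set Omega ->
  test_function Omega chi -> \int[mu]_x ddir e chi x = 0.
Proof.
move=> oO bO tc; have [M M0 cM] := test_bounded tc.
have [N N0 dN] := ddir_bounded e tc.
have [sc _ _] := tc.
(* The weight 1 is not integrable on the plane. It is replaced by the indicator of a ball containing
   every translate of Omega by [t *: e] with [|t| < 1]. *)
have [r [_ hr]] := bO; pose B := ball (0 : R * R) (`|r| + 1 + `|e| + 1).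
have hO x : Omega x -> `|x| <= `|r| + 1.
  by apply: hr; rewrite ltr_pwDr// ler_norm.
have oB : open B by exact: ball_open.
have bB : bounded_set B.
  apply: filterS (nbhs_pinfty_ge (num_real (`|r| + 1 + `|e| + 1))) => m mr x.
  by rewrite /B -ball_normE /= sub0r normrN => /ltW xm; exact: le_trans mr.
have mB := open_measurable_plane oB.
pose w : borel_plane R -> R := \1_B.
have lw : L1 mu w.
  apply: (@L1_bounded_supp B w 1 oB bB).
  - exact: measurable_indic.
  - by move=> x; rewrite /w indicE; case: (_ \in _); rewrite ?normr1 ?normr0.
  - by move=> x nB; rewrite /w indicE memNset.
have OB t x : `|t| < 1 -> Omega (x + t *: e) -> w x = 1.
  move=> t1 /hO h; rewrite /w indicE mem_set// /B -ball_normE /= sub0r normrN.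
  rewrite -[x](addrK (t *: e)) (le_lt_trans (ler_normB _ _))// normrZ.
  have te : `|t| * `|e| <= 1 * `|e| by rewrite ler_wpM2r// ltW.
  by move: te h; rewrite mul1r; set q := `|t| * _; set a := `|_ + _|; set b := `|e|; lra.
have := is_derive_integral_translate 0 lw sc cM dN.
set W := fun s => _; have Wc t : `|t| < 1 -> W t = \int[mu]_x chi x.
  move=> t1; rewrite -[RHS](@Rintegral_translate (t *: e)); last first.
    by apply: continuous_measurable_plane; exact: smooth_continuous.
  apply: eq_Rintegral => x _; have [c0|c0] := eqVneq (chi (x + t *: e)) 0.
    by rewrite c0 mulr0.
  rewrite (OB t)// ?mul1r//.
  by apply: contrapT => /(test_function_out tc) /eqP; exact/negP.
have -> : \int[mu]_x (w x * ddir e chi (x + 0 *: e)) = \int[mu]_x ddir e chi x.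
  apply: eq_Rintegral => x _; rewrite scale0r addr0.
  have [c0|c0] := eqVneq (ddir e chi x) 0; first by rewrite c0 mulr0.
  rewrite (OB 0) ?normr0// ?mul1r// scale0r addr0.
  by apply: contrapT => /(ddir_out e tc) /eqP; exact/negP.
move=> [_ <-].
have cW : is_derive (0 : R) 1 W 0.
  apply: (@near_eq_is_derive _ _ _ (cst (\int[mu]_x chi x))).
  by near=> t; rewrite Wc//; near: t; exact: nbhs0_lt.
by have [_ ->] := cW.
Unshelve. all: by end_near. Qed.

End translated_integrals.

(** * Limits of test functions together with one directional derivative *)

Section directional_limits.
Context {R : realType}.
Notation mu := (lebesgue2 R).
Variables (Omega : set (R * R)) (p : R).
Hypotheses (oO : open Omega) (bO : bounded_set Omega) (p1 : 1 < p).

(** What is kept of [W0]: [V] is the derivative of [U] along the single direction [e]. Both are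
    extended by zero, so that integrals run over the whole plane and can be translated. *)
Record dir_limit (e : R * R) (U V : borel_plane R -> R) (phi : nat -> R * R -> R) : Prop := {
  dl_mU : measurable_fun setT U ;
  dl_mV : measurable_fun setT V ;
  dl_U0 : forall x, ~ Omega x -> U x = 0 ;
  dl_V0 : forall x, ~ Omega x -> V x = 0 ;
  dl_test : forall n, test_function Omega (phi n) ;
  dl_cvgU : (\int[mu]_x (`|phi n x - U x| `^ p)%:E @[n --> \oo] --> 0)%E ;
  dl_cvgV : (\int[mu]_x (`|ddir e (phi n) x - V x| `^ p)%:E @[n --> \oo] --> 0)%E }.

Lemma measurable_normp (f : borel_plane R -> R) : measurable_fun setT f ->
  measurable_fun setT (fun x => `|f x| `^ p).
Proof.
move=> mf; apply: (measurableT_comp (measurable_powR p)).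
exact: measurableT_comp.
Qed.

Lemma test_measurable chi : test_function Omega chi ->
  measurable_fun setT (chi : borel_plane R -> R).
Proof.
by move=> [sc _ _]; apply: continuous_measurable_plane; exact: smooth_continuous.
Qed.

(** Some [f n] is at finite distance from [U], and [f n] is bounded and vanishes off the bounded set
    Omega. *)
Lemma L1p_limit (f : nat -> R * R -> R) (U : borel_plane R -> R) :
  measurable_fun setT U -> (forall n, test_function Omega (f n)) ->
  (\int[mu]_x (`|f n x - U x| `^ p)%:E @[n --> \oo] --> 0)%E ->
  L1 mu (fun x => `|U x| `^ p).
Proof.
move=> mU tf /fine_cvgP[[n _ /(_ n (leqnn n)) fin] _].
have mfU : measurable_fun setT (fun x => `|f n x - U x| `^ p).
  apply: (@measurable_normp (fun x => f n x - U x)).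
  by apply: measurable_funB => //; exact: test_measurable.
have l1 : L1 mu (fun x => `|f n x - U x| `^ p).
  apply/integrableP; split; first exact/measurable_EFinP.
  under eq_integral do rewrite /= ger0_norm ?powR_ge0//.
  by rewrite -ge0_fin_numE// integral_ge0// => x _; rewrite lee_fin powR_ge0.
have p0 : 0 <= p by exact: ltW (lt_trans ltr01 p1).
have l2 : L1 mu (fun x => `|f n x| `^ p).
  have [M M0 fM] := test_bounded (tf n).
  apply: (@L1_bounded_supp _ Omega _ (M `^ p)) => //.
  - by apply: measurable_normp; exact: test_measurable.
  - move=> x; rewrite ger0_norm ?powR_ge0//.
    by apply: ge0_ler_powR => //; rewrite nnegrE// ltW.
  - move=> x nx; rewrite (test_function_out (tf n) nx) normr0 powR0//.
    by rewrite gt_eqF// (lt_trans _ p1).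
apply: (@L1_le _ _ _ _ _ _ _ _ (L1Z (2 `^ p) (L1D l1 l2))).
  exact: measurable_normp.
move=> x; rewrite ger0_norm ?powR_ge0//.
rewrite (le_trans _ (powRD_le p1 _ _))//.
apply: ge0_ler_powR => //; rewrite ?nnegrE ?addr_ge0//.
by rewrite addrC -{1}[U x](subKr (f n x)) ler_normB.
Qed.

Section fixed.
Variables (e : R * R) (U V : borel_plane R -> R) (phi : nat -> R * R -> R).
Hypothesis dl : dir_limit e U V phi.

Let D n := ddir e (phi n).
Let one : borel_plane R -> R := \1_Omega.

(** The indicator of Omega, of finite measure, absorbs constants and thereby all powers of [|U|] and
    [|V|] between 0 and [p]. *)
Definition dom x : R := one x + `|U x| `^ p + `|V x| `^ p.

Definition err n (x : borel_plane R) : R := `|phi n x - U x| `^ p + `|D n x - V x| `^ p.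

Lemma one_in x : Omega x -> one x = 1.
Proof. by move=> Ox; rewrite /one indicE mem_set. Qed.

Lemma one_ge0 x : 0 <= one x.
Proof. by rewrite /one indicE. Qed.

Lemma one_L1 : L1 mu one.
Proof.
apply: (@L1_bounded_supp _ Omega one 1 oO bO).
- by apply: measurable_indic; exact: open_measurable_plane.
- by move=> x; rewrite /one indicE; case: (_ \in _); rewrite ?normr1 ?normr0.
- by move=> x nO; rewrite /one indicE memNset.
Qed.

Lemma Up_L1 : L1 mu (fun x => `|U x| `^ p).
Proof. exact: (L1p_limit (dl_mU dl) (dl_test dl) (dl_cvgU dl)). Qed.

Lemma Vp_L1 : L1 mu (fun x => `|V x| `^ p).
Proof.
apply: (L1p_limit (dl_mV dl) _ (dl_cvgV dl)) => n.
by apply: test_ddir; exact: (dl_test dl).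
Qed.

Lemma dom_L1 : L1 mu dom.
Proof. exact: (L1D (L1D one_L1 Up_L1) Vp_L1). Qed.

Lemma dom_ge0 x : 0 <= dom x.
Proof. by rewrite !addr_ge0 ?powR_ge0 ?one_ge0. Qed.

Lemma err_ge0 n x : 0 <= err n x.
Proof. by rewrite addr_ge0 ?powR_ge0. Qed.

Lemma phi_measurable n : measurable_fun setT (phi n : borel_plane R -> R).
Proof. by apply: test_measurable; exact: (dl_test dl). Qed.

Lemma D_measurable n : measurable_fun setT (D n : borel_plane R -> R).
Proof. by apply: test_measurable; apply: test_ddir; exact: (dl_test dl). Qed.

Lemma errU_measurable n : measurable_fun setT (fun x : borel_plane R => `|phi n x - U x| `^ p).
Proof.
apply: (@measurable_normp (fun x => phi n x - U x)); apply: measurable_funB.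
  exact: phi_measurable.
exact: dl_mU dl.
Qed.

Lemma errV_measurable n : measurable_fun setT (fun x : borel_plane R => `|D n x - V x| `^ p).
Proof.
apply: (@measurable_normp (fun x => D n x - V x)); apply: measurable_funB.
  exact: D_measurable.
exact: dl_mV dl.
Qed.

Lemma err_measurable n : measurable_fun setT (err n).
Proof. by apply: measurable_funD; [exact: errU_measurable|exact: errV_measurable]. Qed.

Lemma err_cvg0 : (\int[mu]_x (err n x)%:E @[n --> \oo] --> 0)%E.
Proof.
have -> : (fun n => \int[mu]_x (err n x)%:E)%E =
  (fun n => \int[mu]_x (`|phi n x - U x| `^ p)%:E + \int[mu]_x (`|D n x - V x| `^ p)%:E)%E.
  apply/funext => n; rewrite -ge0_integralD//.
  - by apply/measurable_EFinP; exact: errU_measurable.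
  - by apply/measurable_EFinP; exact: errV_measurable.
rewrite -[X in _ --> X](adde0 0%E).
by apply: cvgeD => //; [exact: dl_cvgU dl|exact: dl_cvgV dl].
Qed.

(** A pointwise certificate of convergence to 0 in L^1: choose [eps] first, then [n] large, as
    [err n] tends to 0 in L^1. It is stable under sums and bounded factors. *)
Definition small (d : nat -> borel_plane R -> R) : Prop :=
  forall eps, 0 < eps -> exists2 K, 0 < K & forall n x,
    `|d n x| <= eps * dom x + K * err n x.

Lemma small_le (C : R) d d' : small d' ->
  (forall n x, `|d n x| <= C * `|d' n x|) -> small d.
Proof.
move=> sd' h eps e0.
have C0 : 0 < `|C| + 1 by rewrite ltr_pwDr.
have [K K0 hK] := sd' (eps / (`|C| + 1)) ltac:(by rewrite divr_gt0).
exists ((`|C| + 1) * K); first by rewrite mulr_gt0.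
move=> n x; rewrite (le_trans (h n x))//.
rewrite (@le_trans _ _ ((`|C| + 1) * `|d' n x|))//.
  by rewrite ler_wpM2r// (le_trans (ler_norm _))// lerDl.
have := hK n x; rewrite -(ler_pM2l C0) mulrDr mulrA (mulrC (`|C| + 1) (_ / _)).
by rewrite divfK ?gt_eqF// mulrA.
Qed.

Lemma smallD d d' : small d -> small d' -> small (fun n x => d n x + d' n x).
Proof.
move=> sd sd' eps e0.
have [K K0 hK] := sd (eps / 2) ltac:(by rewrite divr_gt0).
have [K' K'0 hK'] := sd' (eps / 2) ltac:(by rewrite divr_gt0).
exists (K + K'); first by rewrite addr_gt0.
move=> n x; rewrite (le_trans (ler_normD _ _))//.
rewrite (le_trans (lerD (hK n x) (hK' n x)))// le_eqVlt.
by apply/orP; left; apply/eqP; field.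
Qed.

Lemma errU_le n x : `|phi n x - U x| `^ p <= err n x.
Proof. by rewrite lerDl powR_ge0. Qed.

Lemma errV_le n x : `|D n x - V x| `^ p <= err n x.
Proof. by rewrite lerDr powR_ge0. Qed.

Lemma phi_out n x : ~ Omega x -> phi n x = 0.
Proof. by move=> nO; exact: test_function_out (dl_test dl n) nO. Qed.

Lemma D_out n x : ~ Omega x -> D n x = 0.
Proof. by move=> nO; exact: ddir_out (dl_test dl n) nO. Qed.

Lemma dom_one x : one x <= dom x.
Proof. by rewrite /dom -addrA lerDl addr_ge0 ?powR_ge0. Qed.

Lemma dom_Up x : `|U x| `^ p <= dom x.
Proof. by rewrite /dom addrAC lerDr addr_ge0 ?powR_ge0 ?one_ge0. Qed.

Lemma dom_Vp x : `|V x| `^ p <= dom x.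
Proof. by rewrite /dom lerDr addr_ge0 ?powR_ge0 ?one_ge0. Qed.

Lemma dom_oneVp x : one x + `|V x| `^ p <= dom x.
Proof. by rewrite /dom addrAC lerDl powR_ge0. Qed.

Lemma dom_oneUp x : one x + `|U x| `^ p <= dom x.
Proof. by rewrite /dom lerDl powR_ge0. Qed.

Lemma dom_V x : `|V x| <= dom x.
Proof.
have [Ox|nO] := pselect (Omega x); last by rewrite (dl_V0 dl nO) normr0 dom_ge0.
rewrite (le_trans _ (dom_oneVp x))// one_in//.
have := le_1DpowR (normr_ge0 (V x)) ltr01 (ltW p1).
by rewrite powRr1.
Qed.

Lemma small_V : small (fun n x => D n x - V x).
Proof.
move=> eps e0; have [K K0 hK] := powR_young p1 e0; exists K => // n x.
have [Ox|nO] := pselect (Omega x); last first.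
  rewrite D_out// (dl_V0 dl nO) subrr normr0 addr_ge0// mulr_ge0 ?(ltW e0) ?(ltW K0)//.
    exact: dom_ge0.
  exact: err_ge0.
(* Young's inequality with [a = 1]: on Omega the constant is paid by [one x]. *)
have := hK 1 `|D n x - V x| ler01 (normr_ge0 _).
rewrite !powR1 mul1r mulr1 => /le_trans; apply; rewrite lerD//.
  rewrite -[leLHS]mulr1 ler_wpM2l ?(ltW e0)// (le_trans _ (dom_one x))//.
  by rewrite one_in.
by rewrite ler_wpM2l ?(ltW K0)// errV_le.
Qed.

Lemma small_U : small (fun n x => phi n x - U x).
Proof.
move=> eps e0; have [K K0 hK] := powR_young p1 e0; exists K => // n x.
have [Ox|nO] := pselect (Omega x); last first.
  rewrite phi_out// (dl_U0 dl nO) subrr normr0 addr_ge0// mulr_ge0 ?(ltW e0) ?(ltW K0)//.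
    exact: dom_ge0.
  exact: err_ge0.
have := hK 1 `|phi n x - U x| ler01 (normr_ge0 _).
rewrite !powR1 mul1r mulr1 => /le_trans; apply; rewrite lerD//.
  rewrite -[leLHS]mulr1 ler_wpM2l ?(ltW e0)// (le_trans _ (dom_one x))//.
  by rewrite one_in.
by rewrite ler_wpM2l ?(ltW K0)// errU_le.
Qed.

Lemma small_Vpow : small (fun n x => `|V x| `^ (p - 1) * (D n x - V x)).
Proof.
move=> eps e0; have [K K0 hK] := powR_young p1 e0; exists K => // n x.
rewrite normrM ger0_norm ?powR_ge0//.
rewrite (le_trans (hK _ _ (normr_ge0 _) (normr_ge0 _)))// lerD//.
  by rewrite ler_wpM2l ?(ltW e0)// dom_Vp.
by rewrite ler_wpM2l ?(ltW K0)// errV_le.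
Qed.

Lemma small_Upow : small (fun n x => `|U x| `^ (p - 1) * (phi n x - U x)).
Proof.
move=> eps e0; have [K K0 hK] := powR_young p1 e0; exists K => // n x.
rewrite normrM ger0_norm ?powR_ge0//.
rewrite (le_trans (hK _ _ (normr_ge0 _) (normr_ge0 _)))// lerD//.
  by rewrite ler_wpM2l ?(ltW e0)// dom_Up.
by rewrite ler_wpM2l ?(ltW K0)// errU_le.
Qed.

Lemma small_flat j : small (fun n x => flat j (phi n x) - flat j (U x)).
Proof.
have [C C0 hC] := @flat_lipschitz R j.
by apply: (small_le (C := C) small_U) => n x; exact: hC.
Qed.

(** In [small_Vpow] and [small_Upow] the exponents are conjugate; here both factors are controlled
    in L^p, and the boundedness of [flat j] is what saves the product. *)
Lemma small_Vflat j : small (fun n x => V x * (flat j (phi n x) - flat j (U x))).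
Proof.
have [C C0 hC] := @flat_lipschitz R j.
move=> eps e0; pose M : R := (j`!%:R + j`!%:R).
have M0 : 0 < M by rewrite addr_gt0// ltr0n fact_gt0.
have [K K0 hK] := mul_bounded_young p1 e0 M0; exists (K * C `^ p).
  by rewrite mulr_gt0// powR_gt0.
move=> n x; set y := flat j _ - _.
have [Ox|nO] := pselect (Omega x); last first.
  rewrite (dl_V0 dl nO) mul0r normr0 addr_ge0// mulr_ge0 ?(ltW e0)//.
  - exact: dom_ge0.
  - by rewrite mulr_ge0 ?powR_ge0// ltW.
  - exact: err_ge0.
have yM : `|y| <= M.
  rewrite (le_trans (ler_normB _ _))// !ger0_norm ?flat_ge0//.
  by rewrite lerD// flat_le.
rewrite normrM (le_trans (hK _ _ (normr_ge0 _) (normr_ge0 _) yM))// lerD//.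
  rewrite ler_wpM2l ?(ltW e0)// (le_trans _ (dom_oneVp x))//.
  by rewrite one_in.
rewrite -mulrA ler_wpM2l ?(ltW K0)//.
rewrite (@le_trans _ _ (C `^ p * `|phi n x - U x| `^ p))//; last first.
  by rewrite ler_wpM2l ?powR_ge0// errU_le.
rewrite -powRM ?(ltW C0)//; apply: ge0_ler_powR; rewrite ?nnegrE ?mulr_ge0 ?(ltW C0)//.
  exact: ltW (lt_trans ltr01 p1).
exact: hC.
Qed.

Lemma small_cvg (F : nat -> borel_plane R -> R) (G : borel_plane R -> R) :
  (forall n, L1 mu (F n)) -> L1 mu G -> small (fun n x => F n x - G x) ->
  \int[mu]_x F n x @[n --> \oo] --> \int[mu]_x G x.
Proof.
move=> lF lG sFG.
exact: (Rintegral_cvg lF lG dom_L1 err_measurable dom_ge0 err_ge0 err_cvg0 sFG).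
Qed.

End fixed.

End directional_limits.

(** * A function increasing along [e] where it is positive is nonpositive *)

Section sign_lemmas.
Context {R : realType}.
Notation mu := (lebesgue2 R).
Variables (Omega : set (R * R)) (p : R).
Hypotheses (oO : open Omega) (bO : bounded_set Omega) (p1 : 1 < p).
Variables (e : R * R) (U V : borel_plane R -> R) (phi : nat -> R * R -> R).
Hypothesis dl : dir_limit Omega p e U V phi.

Lemma bounded_dot2 (a : R * R) : exists2 c : R, 0 < c & forall x, Omega x -> `|dot2 a x| <= c.
Proof.
have [r [_ hr]] := bO; pose N := `|r| + 1.
have hO x : Omega x -> `|x| <= N by apply: hr; rewrite ltr_pwDr// ler_norm.
exists ((`|a.1| + `|a.2|) * N + 1).
  by rewrite ltr_pwDr// mulr_ge0// addr_ge0.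
move=> x /hO; rewrite prod_normE ge_max => /andP[h1 h2].
rewrite /dot2 (le_trans (ler_normD _ _))// !normrM mulrDl.
have := ler_wpM2l (normr_ge0 a.1) h1; have := ler_wpM2l (normr_ge0 a.2) h2.
set A := `|a.1| * `|x.1|; set B := `|a.2| * `|x.2|.
set A' := `|a.1| * N; set B' := `|a.2| * N; lra.
Qed.

(* For an affine [l >= 0] on [Omega] increasing along [e], the divergence theorem
   gives [int (|e|^2 E(u) + l E'(u) v) = 0] with [E = flat 0], where both terms
   are nonnegative. *)
Lemma nonpos_of_derivative_sign : e != 0 ->
  {ae mu, forall x, 0 < U x -> 0 <= V x} -> {ae mu, forall x, U x <= 0}.
Proof.
move=> e0 hs.
have ee0 : 0 < dot2 e e.
  rewrite lt_neqAle eq_sym /dot2 -!expr2 paddr_eq0 ?sqr_ge0// !sqrf_eq0.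
  rewrite addr_ge0 ?sqr_ge0// andbT; apply: contra e0 => /andP[/eqP a /eqP b].
  by rewrite (surjective_pairing e) a b.
have [c c0 hc] := bounded_dot2 e.
pose l x := dot2 e x + c.
have l0 x : Omega x -> 0 <= l x.
  by move=> /hc; rewrite ler_norml /l => /andP[? _]; lra.
have lL x : Omega x -> `|l x| <= c + c.
  move=> Ox; rewrite ger0_norm ?l0// /l lerD2r (le_trans (ler_norm _))//.
  exact: hc.
have sl : smooth l by exact: smooth_affine.
pose chi n x := l x * flat 0 (phi n x).
have sphi n : smooth (phi n) by case: (dl_test dl n).
have schi n : smooth (chi n) by apply: (smoothM sl); exact: (smooth_flat 0 (sphi n)).
have tchi n : test_function Omega (chi n).
  apply: (test_function_of_supp (dl_test dl n) (schi n)) => x.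
  by apply: contraNN => /eqP h; rewrite /chi h flat_eq0// mulr0.
pose F n (x : borel_plane R) := ddir e (chi n) x.
(* The expected limit of [F n]: [flat 2] is the derivative of [flat 0], and [dot2 e e] that of [l]
   along [e]. *)
pose G (x : borel_plane R) := l x * (flat 2 (U x) * V x) + flat 0 (U x) * dot2 e e.
have FE n x : F n x = l x * (flat 2 (phi n x) * ddir e (phi n) x) + flat 0 (phi n x) * dot2 e e.
  rewrite /F /chi (ddirM _ _ sl (smooth_flat 0 (sphi n))).
  by rewrite (ddir_flat _ _ _ (sphi n)) ddir_affine mul0r subr0.
have lF n : L1 mu (F n) by apply: (test_L1 oO bO); exact: test_ddir.
have G_out x : ~ Omega x -> G x = 0.
  by move=> nO; rewrite /G (dl_U0 dl nO) !flat_eq0// !mul0r mulr0 addr0.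
have ml : measurable_fun setT (l : borel_plane R -> R).
  by apply: continuous_measurable_plane; exact: smooth_continuous.
have lG : L1 mu G.
  have mfU j : measurable_fun setT (fun x => flat j (U x)).
    by apply: (measurableT_comp (flat_measurable j)); exact: dl_mU dl.
  apply: (@L1_le _ _ _ _ _ _ _ _ (L1Z (2 * (c + c) + dot2 e e) (dom_L1 oO bO p1 dl))).
    apply: measurable_funD; apply: measurable_funM => //.
    by apply: measurable_funM => //; exact: dl_mV dl.
  move=> x; have [Ox|nO] := pselect (Omega x); last first.
    rewrite G_out// normr0 mulr_ge0 ?dom_ge0//.
    by move: ee0; set q := dot2 e e; lra.
  rewrite (le_trans (ler_normD _ _))// [leRHS]mulrDl lerD//.
    rewrite normrM (mulrC 2) -mulrA ler_pM// ?lL// normrM ler_pM//.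
      by rewrite ger0_norm ?flat_ge0// (flat_le 2).
    exact: (dom_V p1 dl x).
  rewrite normrM mulrC [X in _ * X]ger0_norm ?flat_ge0// (gtr0_norm ee0).
  rewrite ler_wpM2l ?(ltW ee0)// (le_trans (flat_le 0 _))//.
  by rewrite (le_trans _ (dom_one Omega p U V x))// one_in.
(* The difference is telescoped so that each of the three terms varies a single factor: the
   derivative, then [flat 2], then [flat 0]. *)
have sFG : small Omega p e U V phi (fun n x => F n x - G x).
  have s1 : small Omega p e U V phi
      (fun n x => l x * flat 2 (phi n x) * (ddir e (phi n) x - V x)).
    apply: (small_le (C := (c + c) * 2) (small_V p1 dl)) => n x.
    have [Ox|nO] := pselect (Omega x); last first.
      by rewrite (D_out dl n nO) (dl_V0 dl nO) subrr !normr0 !mulr0 normr0.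
    rewrite normrM ler_wpM2r// normrM ler_pM// ?lL//.
    by rewrite ger0_norm ?flat_ge0// (flat_le 2).
  have s2 : small Omega p e U V phi
      (fun n x => l x * (V x * (flat 2 (phi n x) - flat 2 (U x)))).
    apply: (small_le (C := c + c) (small_Vflat p1 dl 2)) => n x.
    have [Ox|nO] := pselect (Omega x); last first.
      by rewrite (dl_V0 dl nO) !mul0r mulr0 normr0 mulr0.
    by rewrite normrM ler_wpM2r// lL.
  have s3 : small Omega p e U V phi
      (fun n x => dot2 e e * (flat 0 (phi n x) - flat 0 (U x))).
    by apply: (small_le (C := `|dot2 e e|) (small_flat p1 dl 0)) => n x; rewrite normrM.
  apply: (small_le (C := 1) (smallD (smallD s1 s2) s3)) => n x.
  rewrite mul1r FE /G le_eqVlt; apply/orP; left; apply/eqP; congr `|_|; ring.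
have iG0 : \int[mu]_x G x = 0.
  apply/esym; apply: (cvg_unique _ _ (small_cvg oO bO p1 dl lF lG sFG)) => //.
  rewrite (_ : (fun n => \int[mu]_x F n x) = cst 0); first exact: cvg_cst.
  by apply/funext => n; exact: integral_ddir_eq0 oO bO (tchi n).
have G0 : {ae mu, forall x, 0 <= G x}.
  apply: filterS hs => x hx.
  have [Ox|nO] := pselect (Omega x); last by rewrite G_out.
  apply: addr_ge0; last by rewrite mulr_ge0 ?flat_ge0 ?(ltW ee0).
  apply: mulr_ge0; first exact: l0.
  have [U0|U0] := leP (U x) 0; first by rewrite flat_eq0// mul0r.
  by rewrite mulr_ge0 ?flat_ge0// hx.
have := Rintegral_eq0_ae lG G0 iG0.
apply: filterS2 hs => x hx Gx.
have [Ox|nO] := pselect (Omega x); last by rewrite (dl_U0 dl nO).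
rewrite leNgt; apply/negP => U0.
(* Strictness comes from the term [flat 0 (U x) * dot2 e e]; the other one is only nonnegative. *)
have : 0 < G x.
  apply: ltr_wpDl; last by rewrite mulr_gt0 ?flat_gt0.
  by rewrite mulr_ge0 ?l0// mulr_ge0 ?flat_ge0// hx.
by rewrite Gx ltxx.
Qed.

End sign_lemmas.

(** * Derivatives of almost minimal functions of one variable *)

Section uniform_limit.
Context {R : realType}.

(* The [W n >= 0] are almost minimal at [0], so their derivatives nearly vanish
   at suitable points on both sides of [0]. *)
Lemma uniform_limit_derivative_eq0 (K W : nat -> R -> R) (L : R -> R) (m : R) : 0 < m ->
  (forall eps : R, 0 < eps -> \forall n \near \oo, forall t, `|K n t - L t| <= eps) ->
  (forall n, continuous (K n)) ->
  (exists2 h : R, 0 < h & forall n (t : R), `|t| < h -> is_derive t 1 (W n) (m * K n t)) ->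
  (forall n t, 0 <= W n t) -> W n 0 @[n --> \oo] --> (0 : R) -> L 0 = 0.
Proof.
move=> m0 cK contK dW' W0' cW0.
apply/eqP; rewrite -normr_eq0; apply/eqP/le_anti; rewrite normr_ge0 andbT.
apply/ler_addgt0Pr => eps' eps'0; rewrite add0r.
pose eps := eps' / 5; have eps0 : 0 < eps by rewrite divr_gt0.
have [h h0 hW] := dW'.
(* The order of the choices matters: [N] for the uniform approximation, [d] from the continuity of
   [K N], then [r], and only then [n >= N] with [W n 0] small compared with [r]. *)
have [N _ hN] := cK _ eps0.
have [d d0 hd] : exists2 d, 0 < d & forall t, `|t| < d -> `|K N 0 - K N t| <= eps.
  have /cvgrPdist_le/(_ _ eps0)/nbhs_ballP[d d0 hd] := contK N 0.
  by exists d => // t td; apply: hd; rewrite /ball/= sub0r normrN.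
pose r := Num.min h d / 2.
have hd0 : 0 < Num.min h d by rewrite lt_min h0.
have r0 : 0 < r by rewrite divr_gt0.
have rhd : r < Num.min h d by rewrite /r; lra.
have [rh rd] : r < h /\ r < d by move: rhd; rewrite lt_min => /andP[].
have emr : 0 < eps * m * r by rewrite !mulr_gt0.
have [n Nn wsmall] : exists2 n, (N <= n)%N & W n 0 <= eps * m * r.
  have /cvgrPdist_le/(_ _ emr)[N' _ hN'] := cW0.
  exists (maxn N N'); first exact: leq_maxl.
  have := hN' (maxn N N') (leq_maxr _ _).
  by rewrite /= sub0r normrN => /(le_trans (ler_norm _)).
(* Four steps of size [eps], through [K N 0], [K N c] and [L c]; the fifth part of [eps'] is spent
   on the slope of [W n]. *)
have main c : `|c| <= r -> `|L 0 - K n c| <= 4 * eps.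
  move=> cr; have cd : `|c| < d by exact: le_lt_trans rd.
  have h1 := hN N (leqnn N) 0; have h2 := hd c cd.
  have h3 := hN N (leqnn N) c; have h4 := hN n Nn c.
  move: h1 h2 h3 h4; rewrite !ler_norml /=.
  set a1 := K N 0; set a2 := L 0; set a3 := K N c; set a4 := L c; set a5 := K n c.
  by move=> /andP[? ?] /andP[? ?] /andP[? ?] /andP[? ?]; apply/andP; split; lra.
have cW a b : - h < a -> b < h -> {within `[a, b], continuous (W n)}.
  move=> ah bh; apply: continuous_in_subspaceT => t; rewrite inE/= in_itv/= => /andP[? ?].
  have [] := hW n t ltac:(by rewrite ltr_norml; apply/andP; split; lra).
  by move=> ? _; exact/differentiable_continuous/derivable1_diffP.
have dW a b t : - h < a -> b < h -> t \in `]a, b[%R -> is_derive t 1 (W n) (m * K n t).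
  move=> ah bh; rewrite in_itv/= => /andP[? ?]; apply: hW.
  by rewrite ltr_norml; apply/andP; split; lra.
have mr0 : 0 < m * r by rewrite mulr_gt0.
have lb : - (5 * eps) <= L 0.
  have a1 : - h < 0 by lra.
  have [c c01 Wc] := MVT_segment (ltW r0) (fun t => @dW 0 r t a1 rh) (cW 0 r a1 rh).
  have cr : `|c| <= r by move: c01; rewrite in_itv/= => /andP[? ?]; rewrite ler_norml; apply/andP; split; lra.
  have := main c cr; rewrite ler_norml => /andP[+ _].
  have Kc : - eps <= K n c.
    rewrite -(ler_pM2r mr0).
    have -> : K n c * (m * r) = W n r - W n 0 by rewrite Wc subr0; ring.
    have -> : - eps * (m * r) = - (eps * m * r) by ring.
    by have := W0' n r; move: wsmall; set a := W n 0; set b := W n r; set z := eps * m * r; lra.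
  by move: Kc; set a := K n c; set b := L 0; lra.
have ub : L 0 <= 5 * eps.
  have a1 : - h < - r by lra.
  have rr : - r <= 0 by rewrite oppr_le0 ltW.
  have [c c01 Wc] := MVT_segment rr (fun t => @dW (- r) 0 t a1 h0) (cW (- r) 0 a1 h0).
  have cr : `|c| <= r by move: c01; rewrite in_itv/= => /andP[? ?]; rewrite ler_norml; apply/andP; split; lra.
  have := main c cr; rewrite ler_norml => /andP[_ +].
  have Kc : K n c <= eps.
    rewrite -(ler_pM2r mr0).
    have -> : K n c * (m * r) = W n 0 - W n (- r) by rewrite Wc sub0r opprK; ring.
    have -> : eps * (m * r) = eps * m * r by ring.
    by have := W0' n (- r); move: wsmall; set a := W n 0; set b := W n (- r); set z := eps * m * r; lra.
  by move: Kc; set a := K n c; set b := L 0; lra.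
have -> : eps' = 5 * eps by rewrite /eps; field.
by rewrite ler_norml lb ub.
Qed.

End uniform_limit.

(** * Sign of the derivative where the eigenfunction does not vanish *)

Section derivative_sign.
Context {R : realType}.
Notation mu := (lebesgue2 R).
Variables (Omega : set (R * R)) (p : R).
Hypotheses (oO : open Omega) (bO : bounded_set Omega) (p1 : 1 < p).
Variables (e : R * R) (U V : borel_plane R -> R) (phi : nat -> R * R -> R).
Hypothesis dl : dir_limit Omega p e U V phi.

Let D n := ddir e (phi n).
Let k x : R := `|U x| `^ (p - 2) * U x.
Let w x : R := Num.max 0 (V x) `^ (p - 1).

Let p10 : 0 < p - 1. Proof. by rewrite subr_gt0. Qed.
Let p10' : p - 1 != 0. Proof. by rewrite gt_eqF. Qed.

(** The exponent [p - 2] may be negative or zero, so [t = 0] is treated apart: both sides vanish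
    there, as [p > 1]. *)
Lemma norm_powB2M (t : R) : `| `|t| `^ (p - 2) * t| = `|t| `^ (p - 1).
Proof.
have [->|t0] := eqVneq t 0; first by rewrite mulr0 normr0 powR0.
rewrite normrM ger0_norm ?powR_ge0// -[X in _ * X = _](@powRr1 _ `|t|)//.
by rewrite -powRD ?normr_eq0 ?t0 ?implybT//; congr (_ `^ _); ring.
Qed.

Lemma k_measurable : measurable_fun setT k.
Proof.
have mU := dl_mU dl; apply: measurable_funM => //.
exact: (@measurable_normp _ (p - 2)).
Qed.

Lemma w_measurable : measurable_fun setT w.
Proof.
apply: (measurableT_comp (measurable_powR (p - 1))).
by apply: measurable_maxr => //; exact: dl_mV dl.
Qed.

Lemma dom_powB1 (f : borel_plane R -> R) x : f = U \/ f = V ->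
  `|f x| `^ (p - 1) <= dom Omega p U V x.
Proof.
move=> fUV; have [Ox|nO] := pselect (Omega x); last first.
  by case: fUV => ->; rewrite ?(dl_U0 dl nO) ?(dl_V0 dl nO) normr0 powR0// dom_ge0.
have pp : p - 1 <= p by rewrite gerBl.
apply: (le_trans (le_1DpowR (normr_ge0 (f x)) p10 pp)); rewrite -[X in X + _](one_in Ox).
by case: fUV => ->; [exact: dom_oneUp|exact: dom_oneVp].
Qed.

Lemma k_L1 : L1 mu k.
Proof.
apply: (L1_le k_measurable _ (dom_L1 oO bO p1 dl)) => x.
by rewrite norm_powB2M; apply: dom_powB1; left.
Qed.

Lemma w_le x : w x <= `|V x| `^ (p - 1).
Proof.
apply: ge0_ler_powR; rewrite ?nnegrE ?le_max ?lexx// ?(ltW p10)//.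
by rewrite ge_max normr_ge0 ler_norm.
Qed.

Lemma w_L1 : L1 mu w.
Proof.
apply: (L1_le w_measurable _ (dom_L1 oO bO p1 dl)) => x.
rewrite ger0_norm ?powR_ge0// (le_trans (w_le x))//.
by apply: dom_powB1; right.
Qed.

(** In the limit over [j], [k * q * flat 0 (s * U)] has zero integral; times [s] it is nonnegative,
    hence null, and where [s * U > 0] only [q] can vanish. It serves with [q = flat 0 (- V)] for a
    positive finite level and with [q = 1] for an infinite one. *)
Lemma sign_of_orthogonal (s : R) (q : borel_plane R -> R) : measurable_fun setT q ->
  (forall x, 0 <= q x <= 1) ->
  (forall j, \int[mu]_x (k x * (q x * flat 0 (s * phi j x))) = 0) ->
  {ae mu, forall x, 0 < s * U x -> q x = 0}.
Proof.
move=> mq q01 orth.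
have q1 x : `|q x| <= 1 by have /andP[? ?] := q01 x; rewrite ger0_norm.
have lF (g : borel_plane R -> R) : measurable_fun setT g ->
    L1 mu (fun x => k x * (q x * flat 0 (s * g x))).
  move=> mg; apply: (@L1_mul_bounded _ _ _ _ _ _ 1 k_L1).
    apply: measurable_funM => //; apply: (measurableT_comp (flat_measurable 0)).
    exact: measurable_funM.
  move=> x; rewrite normrM -[leRHS]mulr1 ler_pM// ger0_norm ?flat_ge0//.
  exact: (flat_le 0).
pose G x := k x * (q x * flat 0 (s * U x)).
have lG : L1 mu G by apply: lF; exact: dl_mU dl.
have [C C0 hC] := @flat_lipschitz R 0.
have iG : \int[mu]_x G x = 0.
  have sm : small Omega p e U V phi
      (fun n x => k x * (q x * flat 0 (s * phi n x)) - G x).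
    apply: (small_le (C := C * `|s|) (small_Upow Omega p1 e U V phi)) => n x.
    rewrite /G -mulrBr -mulrBr normrM norm_powB2M [in leRHS]normrM.
    rewrite (ger0_norm (powR_ge0 _ _)) mulrCA ler_wpM2l ?powR_ge0//.
    rewrite -mulrA -normrM [in leRHS]mulrBr normrM (le_trans _ (hC _ _))//.
    by rewrite -[leRHS]mul1r ler_wpM2r.
  apply/esym; apply: (cvg_unique _ _
    (small_cvg oO bO p1 dl (fun n => lF _ (phi_measurable dl n)) lG sm)) => //.
  rewrite (_ : (fun n => _) = cst 0); first exact: cvg_cst.
  by apply/funext => n; exact: orth.
have lsG := L1Z s lG.
have sG0 x : 0 <= s * G x.
  have -> : s * G x = `|U x| `^ (p - 2) * (s * U x * (q x * flat 0 (s * U x))).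
    by rewrite /G /k; ring.
  rewrite mulr_ge0 ?powR_ge0//.
  have [U0|/ltW U0] := leP (s * U x) 0; first by rewrite flat_eq0// !mulr0.
  have /andP[? _] := q01 x.
  by apply: mulr_ge0 => //; rewrite mulr_ge0 ?flat_ge0.
have isG : \int[mu]_x (s * G x) = 0 by rewrite RintegralZl// iG mulr0.
have := Rintegral_eq0_ae lsG (aeW _ sG0) isG.
apply: filterS => x /eqP sGx sU0; apply/eqP; move: sGx.
have U0 : U x != 0 by apply: contraTneq sU0 => ->; rewrite mulr0 ltxx.
have s0 : s != 0 by apply: contraTneq sU0 => ->; rewrite mul0r ltxx.
rewrite /G /k !mulf_eq0 (negbTE s0) (negbTE U0) powR_eq0 normr_eq0 (negbTE U0) /=.
by rewrite (gt_eqF (flat_gt0 0 sU0)) orbF.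
Qed.

(** * The weak equation with a positive finite level *)

Section eigen.
Variable m : R.
Hypothesis m0 : 0 < m.
Hypothesis weak_eq : forall chi, test_function Omega chi ->
  \int[mu]_x (w x * ddir e chi x) = m * \int[mu]_x (k x * chi x).

Section fixed_cutoff.
Variables (s : R) (j : nat).

(** The first factor is a smooth stand-in for the indicator of [V < 0], the second confines the
    support to that of [phi j]. [psi] is the limit of [chi n]. *)
Let chi n x := flat 0 (- D n x) * flat 0 (s * phi j x).
Let psi (x : borel_plane R) := flat 0 (- V x) * flat 0 (s * phi j x).

Let Kn n t := \int[mu]_x (k x * chi n (x + t *: e)).
Let Kl t := \int[mu]_x (k x * psi (translate (t *: e) x)).
Let Wn n t := \int[mu]_x (w x * chi n (x + t *: e)).

Lemma sphi n : smooth (phi n). Proof. by case: (dl_test dl n). Qed.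

Lemma chi_smooth n : smooth (chi n).
Proof.
have h1 := smooth_flat 0 (smoothN (smooth_ddir e (sphi n))).
have h2 := smooth_flat 0 (smoothZ s (sphi j)).
exact: (smoothM h1 h2).
Qed.

Lemma chi_supp n x : chi n x != 0 -> phi j x != 0.
Proof.
by apply: contraNN => /eqP h; rewrite /chi h mulr0 (@flat_eq0 _ _ 0)// mulr0.
Qed.

Lemma chi_test n : test_function Omega (chi n).
Proof. exact: (test_function_of_supp (dl_test dl j) (chi_smooth n) (@chi_supp n)). Qed.

Lemma chi_le n x : `|chi n x| <= 1.
Proof.
by rewrite normrM -[leRHS]mulr1 ler_pM// ger0_norm ?flat_ge0// (flat_le 0).
Qed.

Lemma psi_le x : `|psi x| <= 1.
Proof.
by rewrite normrM -[leRHS]mulr1 ler_pM// ger0_norm ?flat_ge0// (flat_le 0).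
Qed.

Lemma psi_measurable : measurable_fun setT psi.
Proof.
apply: measurable_funM; apply: (measurableT_comp (flat_measurable 0)).
  by apply: measurableT_comp => //; exact: dl_mV dl.
by apply: measurable_funM => //; exact: phi_measurable dl j.
Qed.

Lemma Kn_L1 n t : L1 mu (fun x => k x * chi n (x + t *: e)).
Proof.
apply: (@L1_mul_bounded _ _ _ _ _ _ 1 k_L1) => [|x]; last exact: chi_le.
by apply: continuous_translate_measurable; apply: smooth_continuous; exact: chi_smooth.
Qed.

Lemma Kl_L1 t : L1 mu (fun x => k x * psi (translate (t *: e) x)).
Proof.
apply: (@L1_mul_bounded _ _ _ _ _ _ 1 k_L1) => [|x]; last exact: psi_le.
by apply: (measurableT_comp psi_measurable); exact: measurable_translate.
Qed.

(** Young's inequality separates [k], which stays in place, from the translated error, whose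
    integral does not depend on [t]. *)
Lemma Kn_uniform_cvg (eps : R) : 0 < eps -> \forall n \near \oo, forall t, `|Kn n t - Kl t| <= eps.
Proof.
have [C C0 hC] := @flat_lipschitz R 0.
apply: (@Rintegral_uniform_cvg _ _ _ mu R
  (fun n t x => k x * chi n (x + t *: e)) (fun t x => k x * psi (translate (t *: e) x))
  (dom Omega p U V) (fun n t x => err p e U V phi n (translate (t *: e) x))
  (fun n => \int[mu]_x (err p e U V phi n x)%:E)%E).
- exact: Kn_L1.
- exact: Kl_L1.
- exact: (dom_L1 oO bO p1 dl).
- move=> n t; apply: (measurableT_comp (err_measurable dl n)).
  exact: measurable_translate.
- by move=> x; exact: dom_ge0.
- by move=> n t x; exact: err_ge0.
- exact: (err_cvg0 dl).
- move=> n t; rewrite (ge0_integral_translate (t *: e) (f := fun x => (err p e U V phi n x)%:E))//.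
    by apply/measurable_EFinP; exact: err_measurable dl n.
  by move=> x; rewrite lee_fin err_ge0.
- move=> {}eps e0; have [K K0 hK] := powR_young p1 e0.
  exists (K * C `^ p); first by rewrite mulr_gt0// powR_gt0.
  move=> n t x; set y : borel_plane R := translate (t *: e) x.
  rewrite -[chi n _]/(chi n y) -mulrBr normrM norm_powB2M.
  rewrite (@le_trans _ _ (`|U x| `^ (p - 1) * (C * `|D n y - V y|)))//.
    rewrite ler_wpM2l ?powR_ge0// /chi /psi -mulrBl normrM.
    rewrite (@le_trans _ _ (`|flat 0 (- D n y) - flat 0 (- V y)| * 1))//.
      by rewrite ler_wpM2l// ger0_norm ?flat_ge0// (flat_le 0).
    by rewrite mulr1 (le_trans (hC _ _))// -opprD normrN.
  have Cd0 : 0 <= C * `|D n y - V y| by rewrite mulr_ge0// ltW.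
  rewrite (le_trans (hK _ _ (normr_ge0 _) Cd0))// lerD//.
    by rewrite ler_wpM2l ?(ltW e0)// dom_Up.
  rewrite powRM ?(ltW C0)// mulrA ler_wpM2l ?mulr_ge0 ?powR_ge0 ?(ltW K0)//.
  exact: errV_le.
Qed.

Lemma Kn_is_derive n (t : R) : is_derive t 1 (Kn n) (\int[mu]_x (k x * ddir e (chi n) (x + t *: e))).
Proof.
have [N _ dN] := ddir_bounded e (chi_test n).
exact: (is_derive_integral_translate t k_L1 (chi_smooth n) (@chi_le n) dN).
Qed.

Lemma Kn_continuous n : continuous (Kn n).
Proof.
by move=> t; have [h _] := Kn_is_derive n t; exact/differentiable_continuous/derivable1_diffP.
Qed.

(** The weak equation is applied to the translate of [chi n], a test function as long as [|t| < h];
    this [h] comes from [phi j] and is the same for all [n]. *)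
Lemma Wn_is_derive : exists2 h : R, 0 < h & forall n (t : R), `|t| < h ->
  is_derive t 1 (Wn n) (m * Kn n t).
Proof.
have [h h0 hh] := test_function_translate oO e (dl_test dl j).
exists h; first exact: h0.
move=> n t th.
have tt := hh _ (chi_smooth n) (@chi_supp n) t th.
rewrite /Kn -weak_eq//.
have [N _ dN] := ddir_bounded e (chi_test n).
have -> : \int[mu]_x (w x * ddir e (fun y => chi n (y + t *: e)) x) =
    \int[mu]_x (w x * ddir e (chi n) (x + t *: e)).
  apply: eq_Rintegral => x _.
  by rewrite (ddir_translate e (t *: e) x (chi_smooth n)).
exact: (is_derive_integral_translate t w_L1 (chi_smooth n) (@chi_le n) dN).
Qed.

Lemma chi_ge0 n x : 0 <= chi n x.
Proof. by rewrite mulr_ge0// flat_ge0. Qed.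

Lemma Wn_ge0 n t : 0 <= Wn n t.
Proof. by apply: Rintegral_ge0 => x _; rewrite mulr_ge0 ?powR_ge0 ?chi_ge0. Qed.

(** [w] lives where [V > 0]; there [flat 0 (- V) = 0], so the cutoff is at most [C * |D n x - V x|]
    by Lipschitz continuity. *)
Lemma Wn0_cvg : Wn n 0 @[n --> \oo] --> (0 : R).
Proof.
have [C C0 hC] := @flat_lipschitz R 0.
have lW n : L1 mu (fun x => w x * chi n (x + 0 *: e)).
  apply: (@L1_mul_bounded _ _ _ _ _ _ 1 w_L1) => [|x]; last exact: chi_le.
  by apply: continuous_translate_measurable; apply: smooth_continuous; exact: chi_smooth.
have l0 : L1 mu (cst 0 : borel_plane R -> R) by exact: integrable0.
have i0 : \int[mu]_x (cst 0 : borel_plane R -> R) x = 0 by rewrite /Rintegral integral0.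
suff sm : small Omega p e U V phi (fun n x => w x * chi n (x + 0 *: e) - cst 0 x).
  by have := small_cvg oO bO p1 dl lW l0 sm; rewrite i0.
apply: (small_le (C := C) (small_Vpow Omega p1 e U V phi)) => n x; rewrite scale0r addr0 subr0.
rewrite !normrM (ger0_norm (powR_ge0 _ _)) (ger0_norm (powR_ge0 _ _)).
have [V0|V0] := leP (V x) 0.
  by rewrite powR0// mul0r !mulr_ge0 ?powR_ge0// ltW.
rewrite [leRHS]mulrCA (gtr0_norm V0) ler_wpM2l ?powR_ge0//.
rewrite (@le_trans _ _ (`|flat 0 (- D n x)| * 1))//.
  by rewrite ler_wpM2l// ger0_norm ?flat_ge0// (flat_le 0).
rewrite mulr1; have := hC (- D n x) (- V x).
by rewrite (@flat_eq0 _ 0 (- V x)) ?subr0 -?opprD ?normrN// oppr_le0 ltW.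
Qed.

Lemma Kl0_eq0 : Kl 0 = 0.
Proof.
exact: (uniform_limit_derivative_eq0 m0 Kn_uniform_cvg Kn_continuous Wn_is_derive
  Wn_ge0 Wn0_cvg).
Qed.

End fixed_cutoff.
(* With [w = (v^+)^(p-1)] the equation reads [- D_e w = m k]; the nonnegative
   [w] is minimal where [v < 0], so its derivative vanishes there and [k = 0]. *)
Lemma derivative_sign s : {ae mu, forall x, 0 < s * U x -> 0 <= V x}.
Proof.
have mq : measurable_fun setT (fun x => flat 0 (- V x)).
  apply: (measurableT_comp (flat_measurable 0)); apply: measurableT_comp => //.
  exact: dl_mV dl.
have q01 x : 0 <= flat 0 (- V x) <= 1 by rewrite flat_ge0 (flat_le 0).
have := @sign_of_orthogonal s _ mq q01.
move=> /(_ _)/filterS; apply.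
  move=> x h sU; rewrite leNgt; apply/negP => V0; have := h sU.
  by move/eqP; rewrite gt_eqF// flat_gt0// oppr_gt0.
move=> j; rewrite -[RHS](Kl0_eq0 s j); apply: eq_Rintegral => x _.
by rewrite /translate scale0r addr0.
Qed.

End eigen.
End derivative_sign.

(** * Shape of [H] when its kernel is a half-plane *)

Section half_plane_kernel.
Context {R : realType}.
Implicit Types (H : R * R -> R) (x y e : R * R).

(** Convexity at the midpoint of [2 x] and [2 y]; homogeneity cancels the factors. *)
Lemma scriptH_subadditive H x y : scriptH H -> H (x + y) <= H x + H y.
Proof.
move=> [_ cH hH]; have h0 : 0 <= 2^-1 :> R by rewrite invr_ge0.
have h1 : 2^-1 <= 1 :> R by rewrite invf_le1 ?ler1n.
pose t : {i01 R} := Itv01 h0 h1.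
have := cH t (2%:R *: x) (2%:R *: y) (mem_setT _) (mem_setT _).
have -> : conv t (2%:R *: x : convex_lmodType (R * R)%type) (2%:R *: y) = x + y.
  rewrite [LHS]/(2^-1 *: (2%:R *: x) + (1 - 2^-1) *: (2%:R *: y)) !scalerA mulVf ?pnatr_eq0// scale1r.
  by rewrite (_ : (1 - 2^-1) * 2%:R = 1 :> R) ?scale1r//; field.
rewrite convRE !hH ?ltr0n// => /le_trans; apply.
rewrite -[leLHS]/(2^-1 * (2%:R * H x) + (1 - 2^-1) * (2%:R * H y)).
by rewrite le_eqVlt; apply/orP; left; apply/eqP; field.
Qed.

(** The orthogonal projection [y] of [x] on the boundary line lies in the kernel together with
    [- y], so subadditivity used twice shows that only the component along [nu] counts. *)
Lemma scriptH_half_plane H : scriptH H -> half_plane (ker H) ->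
  exists2 e, e != 0 & forall x, H x = Num.max 0 (dot2 e x).
Proof.
move=> sH [nu [nu0 kerE]]; have [H0 _ hH] := sH.
have kerP x : H x = 0 <-> 0 <= dot2 nu x.
  by rewrite -[H x = 0]/(ker H x) kerE.
pose N := dot2 nu nu.
have N0 : 0 < N.
  rewrite lt_neqAle eq_sym /N /dot2 -!expr2 paddr_eq0 ?sqr_ge0// !sqrf_eq0.
  rewrite addr_ge0 ?sqr_ge0// andbT; apply: contra nu0 => /andP[/eqP a /eqP b].
  by rewrite (surjective_pairing nu) a b.
have HN0 : 0 < H (- nu).
  rewrite lt_neqAle H0 andbT eq_sym; apply/eqP => /kerP.
  have -> : dot2 nu (- nu) = - N by rewrite /N /dot2 /=; ring.
  by rewrite oppr_ge0 leNgt N0.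
(* Normalized so that the linear form of [(- a) *: nu] takes the value [H (- nu)] at [- nu]. *)
pose a := H (- nu) / N.
have a0 : 0 < a by rewrite divr_gt0.
have dE x : dot2 ((- a) *: nu) x = - a * dot2 nu x.
  by rewrite /dot2 /= /GRing.scale/=; ring.
exists ((- a) *: nu); first by rewrite scaler_eq0 negb_or oppr_eq0 gt_eqF.
move=> x; rewrite dE; have [x0|x0] := leP 0 (dot2 nu x).
  rewrite max_l; first exact/kerP.
  by rewrite mulNr oppr_le0 mulr_ge0// ltW.
rewrite max_r; last by rewrite mulNr -mulrN mulr_ge0 ?oppr_ge0 ?ltW.
pose t := - dot2 nu x / N; have t0 : 0 < t by rewrite divr_gt0// oppr_gt0.
pose y := x + t *: nu.
have y0 : dot2 nu y = 0.
  have -> : dot2 nu y = dot2 nu x + t * N.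
    by rewrite /y /N /dot2 /= /GRing.scale/=; ring.
  by rewrite /t divfK ?gt_eqF// subrr.
have Hy : H y = 0 by apply/kerP; rewrite y0.
have HNy : H (- y) = 0.
  apply/kerP; have -> : dot2 nu (- y) = - dot2 nu y by rewrite /dot2 /=; ring.
  by rewrite y0 oppr0.
have -> : - a * dot2 nu x = t * H (- nu) by rewrite /a /t; field; rewrite gt_eqF.
rewrite -hH//; apply/le_anti/andP; split.
  have -> : x = t *: (- nu) + y by rewrite /y scalerN addrC addrK.
  by rewrite (le_trans (scriptH_subadditive _ _ sH))// Hy addr0.
have -> : t *: (- nu) = x + - y by rewrite /y opprD addrA subrr add0r scalerN.
by rewrite (le_trans (scriptH_subadditive _ _ sH))// HNy addr0.
Qed.

Lemma grad_max_affine e x : 0 < dot2 e x -> grad (fun y => Num.max 0 (dot2 e y)) x = e.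
Proof.
move=> ex.
have nE : \forall y \near x, dot2 e y + 0 = Num.max 0 (dot2 e y).
  have c : dot2 e y + 0 @[y --> x] --> dot2 e x + 0 := @affine_continuous _ e 0 x.
  have ex' : 0 < dot2 e x + 0 by rewrite addr0.
  near=> y; have : 0 < dot2 e y + 0.
    by near: y; exact: (cvgr_gt (dot2 e x + 0) c _ ex').
  by rewrite addr0 => /ltW y0; rewrite max_r.
have dE b : partial b (fun y => Num.max 0 (dot2 e y)) x = dot2 e (axis b).
  rewrite partialE -(near_eq_derive (axis b) nE).
  by have [_ E] := is_derive_affine e 0 x (axis b); exact: E.
by rewrite /grad !dE /dot2 /= !mulr1 !mulr0 addr0 add0r -surjective_pairing.
Unshelve. all: by end_near. Qed.

Lemma flux_max_affine (p : R) e x y : 1 < p ->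
  let H z := Num.max 0 (dot2 e z) in
  H x `^ (p - 1) * dot2 (grad H x) y = H x `^ (p - 1) * dot2 e y.
Proof.
move=> p1 H; have [x0|x0] := leP (dot2 e x) 0; last by rewrite grad_max_affine.
by rewrite /H max_l// powR0 ?mul0r// gt_eqF// subr_gt0.
Qed.

End half_plane_kernel.

(** * From the Sobolev space to directional limits *)

Section W0_dir_limit.
Context {R : realType}.
Notation mu := (lebesgue2 R).
Variables (Omega : set (R * R)) (p : R).
Hypotheses (oO : open Omega) (p1 : 1 < p).

Let p0 : 0 < p. Proof. exact: lt_trans ltr01 p1. Qed.

Lemma Lp_norm_pow (f : R * R -> R) :
  (Lp_norm p Omega f `^ p)%E = (\int[mu]_x (`|(f \_ Omega) x| `^ p)%:E)%E.
Proof.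
rewrite /Lp_norm poweR_Lnorm ?gt_eqF//; apply: eq_integral => x _.
by rewrite !patchE; case: ifP => _ //=; rewrite abse0 normr0 poweR_EFin.
Qed.

Lemma cvg_poweR0 (a : nat -> \bar R) : (forall n, 0 <= a n)%E ->
  (a n @[n --> \oo] --> 0)%E -> (a n `^ p @[n --> \oo] --> 0)%E.
Proof.
move=> a0 /fine_cvgP[afin /cvgrPdist_le acvg]; apply/fine_cvgP; split.
  by apply: filterS afin => n; exact: fin_num_poweR.
apply/cvgrPdist_le => eps eps0.
have := acvg (eps `^ p^-1) (powR_gt0 _ eps0); apply: filterS => n /=.
rewrite !sub0r !normrN fine_poweR [X in _ -> X <= _]ger0_norm ?powR_ge0//.
rewrite ger0_norm ?fine_ge0// => h.
have -> : eps = (eps `^ p^-1) `^ p by rewrite -powRrM mulVf ?powRr1 ?gt_eqF// ltW.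
by apply: ge0_ler_powR => //; rewrite ?nnegrE ?powR_ge0 ?fine_ge0// ltW.
Qed.

Lemma Lp_norm_cvg0 (f : nat -> R * R -> R) : Lp_norm p Omega (f n) @[n --> \oo] --> 0%E ->
  (\int[mu]_x (`|(f n \_ Omega) x| `^ p)%:E @[n --> \oo] --> 0)%E.
Proof.
move=> /(cvg_poweR0 (fun n => Lnorm_ge0 _ _ _)).
by under eq_fun do rewrite [X in (X `^ p)%E]/(Lp_norm p Omega (f _)) Lp_norm_pow.
Qed.

Lemma normr_dot2_le (e a : R * R) : `|dot2 e a| <= (`|e.1| + `|e.2|) * euclid a.
Proof.
have h (b : R) : b ^+ 2 <= dot2 a a -> `|b| <= euclid a.
  by move=> h; rewrite -sqrtr_sqr; exact: ler_wsqrtr.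
have h1 : `|a.1| <= euclid a by apply: h; rewrite /dot2 -!expr2 lerDl sqr_ge0.
have h2 : `|a.2| <= euclid a by apply: h; rewrite /dot2 -!expr2 lerDr sqr_ge0.
rewrite /dot2 (le_trans (ler_normD _ _))// !normrM mulrDl.
by rewrite lerD// ler_wpM2l.
Qed.

Lemma W0_dir_limit e u g : W0 p Omega u g -> exists phi,
  dir_limit Omega p e (u \_ Omega) ((fun x => dot2 e (g x)) \_ Omega) phi.
Proof.
move=> [mu_ mg [phi [tphi cu cg]]]; exists phi.
have mO := open_measurable_plane oO.
have mg1 := measurableT_comp (@measurable_fst _ _ R R) mg.
have mg2 := measurableT_comp (@measurable_snd _ _ R R) mg.
have me : measurable_fun (Omega : set (borel_plane R)) (fun x => dot2 e (g x)).
  by apply: measurable_funD; apply: measurable_funM.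
have mU : measurable_fun setT ((u \_ Omega) : borel_plane R -> R).
  by apply/measurable_restrict => //; rewrite setTI.
have mV : measurable_fun setT (((fun x => dot2 e (g x)) \_ Omega) : borel_plane R -> R).
  by apply/measurable_restrict => //; rewrite setTI.
split => //.
- by move=> x nO; rewrite patchE memNset.
- by move=> x nO; rewrite patchE memNset.
- have -> : (fun n => \int[mu]_x (`|phi n x - (u \_ Omega) x| `^ p)%:E)%E =
      (fun n => \int[mu]_x (`|((fun x => phi n x - u x) \_ Omega) x| `^ p)%:E)%E.
    apply/funext => n; apply: eq_integral => x _; rewrite !patchE; case: ifPn => // /negP.
    by rewrite inE => nO; rewrite (test_function_out (tphi n) nO) subr0.
  exact: Lp_norm_cvg0 cu.
- pose E n := (fun x => euclid (grad (phi n) x - g x)) \_ Omega.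
  (* The constant of [normr_dot2_le], which bounds the error along [e] by the Euclidean norm of the
     error on gradients. *)
  pose C := `|e.1| + `|e.2|; have C0 : 0 <= C by rewrite addr_ge0.
  have mE n : measurable_fun setT (E n : borel_plane R -> R).
    apply/measurable_restrict => //; rewrite setTI.
    have mp b : measurable_fun (Omega : set (borel_plane R)) (partial b (phi n)).
      apply: (@measurable_funS _ _ _ _ setT) => //; apply: continuous_measurable_plane.
      by apply: smooth_continuous; apply: smooth_partial; case: (tphi n).
    have msqrt : measurable_fun setT (@Num.sqrt R).
      by apply: continuous_measurable_fun; exact: sqrt_continuous.
    have md b : measurable_fun (Omega : set (borel_plane R))
        (fun x => partial b (phi n) x - (if b then (g x).2 else (g x).1)).
      by apply: measurable_funB => //; case: b.
    exact: (measurableT_comp msqrt (measurable_funD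
      (measurable_funM (md false) (md false)) (measurable_funM (md true) (md true)))).
  have leE n : (\int[mu]_x (`|ddir e (phi n) x - ((fun x => dot2 e (g x)) \_ Omega) x| `^ p)%:E
      <= (C `^ p)%:E * \int[mu]_x (`|E n x| `^ p)%:E)%E.
    rewrite -ge0_integralZl ?lee_fin ?powR_ge0//; last first.
      by apply/measurable_EFinP; exact: measurable_normp.
    apply: ge0_le_integral => //.
    - apply/measurable_EFinP; apply: (@measurable_normp _ p (fun x => _ - _)).
      apply: measurable_funB => //; apply: continuous_measurable_plane.
      by apply: smooth_continuous; apply: smooth_ddir; case: (tphi n).
    - apply/measurable_EFinP; apply: measurable_funM => //.
      exact: measurable_normp.
    - move=> x _; rewrite -EFinM lee_fin -powRM//.
      apply: ge0_ler_powR; rewrite ?nnegrE ?mulr_ge0 ?(ltW p0)//.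
      rewrite /E !patchE; case: ifPn => [_|/negP]; last first.
        by rewrite inE => nO; rewrite (ddir_out e (tphi n) nO) subr0 normr0 mulr_ge0.
      have -> : ddir e (phi n) x - dot2 e (g x) = dot2 e (grad (phi n) x - g x).
        by rewrite /ddir /dot2 /=; ring.
      by rewrite (le_trans (normr_dot2_le _ _))// ler_wpM2l// ler_norm.
  have cE : ((C `^ p)%:E * \int[mu]_x (`|E n x| `^ p)%:E @[n --> \oo] --> 0)%E.
    rewrite -[X in _ --> X](mule0 (C `^ p)%:E).
    by apply: cvgeZl => //; exact: Lp_norm_cvg0 cg.
  have sq : \forall n \near \oo, ((0 : \bar R) <=
      \int[mu]_x (`|ddir e (phi n) x - ((fun x => dot2 e (g x)) \_ Omega) x| `^ p)%:E
      <= (C `^ p)%:E * \int[mu]_x (`|E n x| `^ p)%:E)%E.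
    apply: nearW => k; rewrite leE andbT; apply: integral_ge0 => x _.
    by rewrite lee_fin powR_ge0.
  exact: (squeeze_cvge sq (cvg_cst 0%E) cE).
Qed.

End W0_dir_limit.

(** * Change of sign and reversal of the direction *)

Section dir_limit_symmetries.
Context {R : realType}.
Notation mu := (lebesgue2 R).
Variables (Omega : set (R * R)) (p : R).
Implicit Types (e : R * R) (U V : borel_plane R -> R) (phi : nat -> R * R -> R).

(** Together with [dir_limit_oppdir], it lets [nonpos_of_derivative_sign], stated for one sign and
    one orientation, cover all the others. *)
Lemma dir_limitN e U V phi : dir_limit Omega p e U V phi ->
  dir_limit Omega p e (fun x => - U x) (fun x => - V x) (fun n x => - phi n x).
Proof.
move=> dl; have s n : smooth (phi n) by case: (dl_test dl n).
split.
- exact: measurableT_comp (dl_mU dl).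
- exact: measurableT_comp (dl_mV dl).
- by move=> x nO; rewrite (dl_U0 dl nO) oppr0.
- by move=> x nO; rewrite (dl_V0 dl nO) oppr0.
- move=> n; apply: (test_function_of_supp (dl_test dl n) (smoothN (s n))) => x.
  by rewrite oppr_eq0.
- rewrite [X in X @ _](_ : _ = (fun n => \int[mu]_x (`|phi n x - U x| `^ p)%:E)%E).
    exact: dl_cvgU dl.
  by apply/funext => n; apply: eq_integral => x _; rewrite -opprD normrN.
- rewrite [X in X @ _](_ : _ = (fun n => \int[mu]_x (`|ddir e (phi n) x - V x| `^ p)%:E)%E).
    exact: dl_cvgV dl.
  apply/funext => n; apply: eq_integral => x _.
  have -> : ddir e (fun y => - phi n y) x = - ddir e (phi n) x.
    by rewrite /ddir (gradN _ (s n)) /dot2 /= !mulrN opprD.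
  by rewrite -opprD normrN.
Qed.

Lemma dir_limit_oppdir e U V phi : dir_limit Omega p e U V phi ->
  dir_limit Omega p (- e) U (fun x => - V x) phi.
Proof.
move=> [mU mV U0 V0 t cU cV]; split; [exact: mU| |exact: U0| |exact: t|exact: cU|].
- exact: measurableT_comp mV.
- by move=> x nO; rewrite V0 ?oppr0.
- rewrite [X in X @ _](_ : _ = (fun n => \int[mu]_x (`|ddir e (phi n) x - V x| `^ p)%:E)%E).
    exact: cV.
  by apply/funext => n; apply: eq_integral => x _; rewrite ddirNl -opprD normrN.
Qed.

End dir_limit_symmetries.

(** * Test functions in the weak equation; sign of the level *)

Section weak_equation.
Context {R : realType}.
Notation mu := (lebesgue2 R).
Variables (Omega : set (R * R)) (p : R).
Hypotheses (oO : open Omega) (bO : bounded_set Omega) (p1 : 1 < p).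

Lemma test_W0 chi : test_function Omega chi -> W0 p Omega chi (grad chi).
Proof.
move=> tc; have [sc _ _] := tc; have mO := open_measurable_plane oO.
have mc (f : R * R -> R) : smooth f -> measurable_fun setT (f : borel_plane R -> R).
  by move=> sf; apply: continuous_measurable_plane; exact: smooth_continuous.
have z (f : R * R -> R) : (forall x, f x = 0) -> Lp_norm p Omega f = 0%E.
  move=> f0; rewrite /Lp_norm (_ : _ \_ _ = cst 0%E) ?Lnorm0//.
    by rewrite eqe gt_eqF// (lt_trans ltr01 p1).
  by apply/funext => x; rewrite patchE /= f0; case: ifP.
split.
- by apply: (@measurable_funS _ _ _ _ setT) => //; exact: mc.
- apply: (@measurable_funS _ _ _ _ setT) => //.
  by apply: measurable_fun_pair; apply: mc; exact: smooth_partial.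
exists (fun=> chi); split => //.
  by rewrite z ?subrr//; [exact: cvg_cst|move=> x; rewrite subrr].
rewrite z; first exact: cvg_cst.
by move=> x; rewrite subrr /euclid /dot2 /= !mul0r addr0 sqrtr0.
Qed.

Lemma integral_restrict (f g : borel_plane R -> R) :
  (forall x, Omega x -> f x = g x) -> (forall x, ~ Omega x -> g x = 0) ->
  (\int[mu]_(x in Omega) (f x)%:E = \int[mu]_x (g x)%:E)%E.
Proof.
move=> fg g0; rewrite integral_mkcond; apply: eq_integral => x _.
rewrite patchE; case: ifPn => [|/negP]; rewrite inE => Ox; first by rewrite fg.
by rewrite g0.
Qed.

Lemma lambda_ge0 (H : R * R -> R) : (0 <= lambda p H Omega)%E.
Proof.
apply: le_ereal_inf_tmp => _ [u [g [_ _ ->]]].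
by apply: integral_ge0 => x _; rewrite lee_fin powR_ge0.
Qed.

End weak_equation.

(** * Discussion according to the value of the level *)

Theorem theorem1p3 (R : realType) (p : R) (hp : 1 < p)
    (Omega : set (R * R)) (hOmega : bounded_domain Omega)
    (H : R * R -> R) (hH : scriptH_D H) (hH0 : H <> (fun=> 0))
    (hker : half_plane (ker H)) :
  ~ fundamental_frequency p H Omega.
Proof.
move=> [u [g [Wu nu0 _ _ weak]]].
have [oO _ _ bO] := hOmega.
have [e e0 /funext HE] := scriptH_half_plane hH.1 hker.
have [phi dl] := W0_dir_limit oO hp e Wu.
set U : borel_plane R -> R := u \_ Omega in dl.
set V : borel_plane R -> R := (fun x => dot2 e (g x)) \_ Omega in dl.
pose mu := lebesgue2 R.
have UE x : Omega x -> U x = u x by move=> Ox; rewrite /U patchE mem_set.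
have VE x : Omega x -> V x = dot2 e (g x) by move=> Ox; rewrite /V patchE mem_set.
pose w x := Num.max 0 (V x) `^ (p - 1).
pose k x := `|U x| `^ (p - 2) * U x.
have p10 : p - 1 != 0 by rewrite gt_eqF// subr_gt0.
have lw : L1 mu w := w_L1 oO bO hp dl.
have lk : L1 mu k := k_L1 oO bO hp dl.
have U_out x : ~ Omega x -> U x = 0 := @dl_U0 _ _ _ _ _ _ _ dl x.
have V_out x : ~ Omega x -> V x = 0 := @dl_V0 _ _ _ _ _ _ _ dl x.
have w_out x : ~ Omega x -> w x = 0.
  by move=> nO; rewrite /w V_out// maxxx powR0.
have k_out x : ~ Omega x -> k x = 0 by move=> nO; rewrite /k U_out// mulr0.
have fluxE x y : Omega x -> H (g x) `^ (p - 1) * dot2 (grad H (g x)) y = w x * dot2 e y.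
  by move=> Ox; rewrite HE (flux_max_affine _ _ _ hp) /w VE.
have weak_test chi : test_function Omega chi ->
    ((\int[mu]_x (w x * ddir e chi x))%:E
     = lambda p H Omega * (\int[mu]_x (k x * chi x))%:E)%E.
  move=> tc; have := weak _ _ (test_W0 oO hp tc).
  have [M _ cM] := test_bounded tc; have [N _ dN] := ddir_bounded e tc.
  rewrite (@integral_restrict _ Omega _ (fun x => w x * ddir e chi x)); first last.
  - by move=> x nO; rewrite (w_out _ nO) mul0r.
  - by move=> x Ox; exact: fluxE.
  rewrite (@integral_restrict _ Omega _ (fun x => k x * chi x)); first last.
  - by move=> x nO; rewrite (k_out _ nO) mul0r.
  - by move=> x Ox; rewrite /k UE.
  rewrite !L1_EFin//.
  - by apply: (L1_mul_bounded lk _ cM); exact: (test_measurable tc).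
  - by apply: (L1_mul_bounded lw _ dN); exact: (test_measurable (test_ddir e tc)).
have dl' := dir_limitN dl; have dle := dir_limit_oppdir dl.
have dle' := dir_limit_oppdir dl'.
have Ne0 : - e != 0 by rewrite oppr_eq0.
suff [le0 ge0] : {ae mu, forall x, U x <= 0} /\ {ae mu, forall x, - U x <= 0}.
  apply: nu0; move: le0 ge0; apply: filterS2 => x le0 ge0 Ox.
  by rewrite -UE//; apply/le_anti; rewrite le0 -oppr_le0 ge0.
have := lambda_ge0 Omega p H.
(* Nonnegativity excludes [-oo]. Keeping [+oo] as a case avoids exhibiting a competitor of finite
   energy in the infimum. *)
case El : (lambda p H Omega) => [m| |] // m0.
- move: m0; rewrite lee_fin le_eqVlt => /predU1P[m0|m0].
  + have V0 : {ae mu, forall x, V x <= 0}.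
      have := weak _ _ Wu; rewrite El -m0 mul0e.
      rewrite (@integral_restrict _ Omega _ (fun x => Num.max 0 (V x) `^ p)); first last.
      * by move=> x nO; rewrite V_out// maxxx powR0// gt_eqF// (lt_trans ltr01 hp).
      * move=> x Ox; rewrite fluxE// /w -VE//.
        have [V0|V0] := leP (V x) 0; last by rewrite mulrC mulr_powRB1// ?ltW// (lt_trans ltr01 hp).
        by rewrite !powR0 ?mul0r// gt_eqF// (lt_trans ltr01 hp).
      have lV : L1 mu (fun x => Num.max 0 (V x) `^ p).
        apply: L1_le (Vp_L1 oO bO hp dl).
          apply: (measurableT_comp (measurable_powR p)).
          by apply: measurable_maxr => //; exact: dl_mV dl.
        move=> x; rewrite ger0_norm ?powR_ge0//; apply: ge0_ler_powR.
        * exact: ltW (lt_trans ltr01 hp).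
        * by rewrite nnegrE le_max lexx.
        * by rewrite nnegrE.
        * by rewrite ge_max normr_ge0 ler_norm.
      rewrite L1_EFin// => -[] iV0.
      have := Rintegral_eq0_ae lV (aeW _ (fun x => powR_ge0 _ _)) iV0.
      apply: filterS => x /powR_eq0_eq0 maxV.
      by rewrite -maxV le_max lexx orbT.
    split.
      (* As [V <= 0], the derivative [- V] of [U] along [- e] is nonnegative, and so is that of
         [- U] along [e]. *)
      apply: (nonpos_of_derivative_sign oO bO hp dle Ne0).
      by apply: filterS V0 => x V0 _; rewrite oppr_ge0.
    apply: (nonpos_of_derivative_sign oO bO hp dl' e0).
    by apply: filterS V0 => x V0 _; rewrite oppr_ge0.
  + have weak_eq chi : test_function Omega chi ->
        \int[mu]_x (w x * ddir e chi x) = m * \int[mu]_x (k x * chi x).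
      by move=> /weak_test; rewrite El -EFinM => -[].
    have sgn := derivative_sign oO bO hp dl m0 weak_eq.
    split.
      apply: (nonpos_of_derivative_sign oO bO hp dl e0).
      by apply: filterS (sgn 1) => x; rewrite mul1r.
    (* Along [- e] the function [- U] has derivative [V], nonnegative where [U < 0]. *)
    apply: (nonpos_of_derivative_sign oO bO hp dle' Ne0).
    by apply: filterS (sgn (-1)) => x; rewrite mulN1r opprK.
- have orth chi : test_function Omega chi -> \int[mu]_x (k x * chi x) = 0.
    move=> /weak_test; rewrite El; set B := \int[mu]_x (k x * chi x).
    (* A nonzero [B] would make the right-hand side infinite, while the left-hand side is a real
       number. *)
    have [B0|B0|->//] := ltgtP B 0.
    + by rewrite lt0_mulye ?lte_fin.
    + by rewrite gt0_mulye ?lte_fin.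
  (* With [q = 1] the absurd conclusion says that [s * U > 0] holds almost nowhere. *)
  have sgn (s : R) : {ae mu, forall x, 0 < s * U x -> 1 = 0 :> R}.
    apply: (sign_of_orthogonal oO bO hp dl (q := cst 1)) => //.
      by move=> x; rewrite ler01 lexx.
    move=> j; rewrite -[RHS](orth (fun x => flat 0 (s * phi j x))).
      by apply: eq_Rintegral => x _; rewrite mul1r.
    have sj : smooth (phi j) by case: (dl_test dl j).
    apply: (test_function_of_supp (dl_test dl j) (smooth_flat 0 (smoothZ s sj))) => x.
    by apply: contraNN => /eqP h; rewrite /= h mulr0 flat_eq0.
  split.
    apply: filterS (sgn 1) => x; rewrite mul1r leNgt => h; apply/negP => /h/eqP.
    by rewrite oner_eq0.
  apply: filterS (sgn (-1)) => x; rewrite mulN1r leNgt => h; apply/negP => /h/eqP.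
  by rewrite oner_eq0.
Qed.
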